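(* Let $\alpha>-1$, $1<q<p<\infty$. Let $\omega$ be a weight and $\mu$ a positive Borel measure on $\mathcal H$. Assume that $\Phi\in B_p$ and that the function $$K_\mu(z):=\sup_{I\subset\mathbb R,\ I\text{ interval},\ z\in Q_I}\frac{\mu(Q_I)}{|Q_I|_{\omega,\alpha}}$$ belongs to $L^s(\mathcal H,(\mathcal{M}_\alpha\omega)\,dV_\alpha)$, where $s=\frac{p}{p-q}$. Then there is a constant $C>0$ such that for any function $f$, $$\left(\int_{\mathcal H}\left(\mathcal{M}_{\Phi,\alpha}f(z)\right)^q d\mu(z)\right)^{1/q}\le C\left(\int_{\mathcal H}|f(z)|^p\,\mathcal{M}_\alpha\omega(z)\,dV_\alpha(z)\right)^{1/p}.$$
   Context: $\mathcal H=\{z=x+iy\in\mathbb C: x\in\mathbb R,\ y>0\}$ is the upper-half plane and $dV_\alpha(x+iy)=y^\alpha\,dx\,dy$. A weight is a nonnegative locally integrable function on $\mathcal H$. Functions $f$ are measurable on $\mathcal H$. $L^s(\mathcal H,\sigma\,dV_\alpha)$ is the set of functions $g$ on $\mathcal H$ with $\int_{\mathcal H}|g|^s\sigma\,dV_\alpha<\infty$. Intervals $I\subset\mathbb R$ are bounded and of positive length $|I|$; the Carleson square of $I$ is $Q_I=\{x+iy: x\in I,\ 0<y<|I|\}$. For $E\subset\mathcal H$ measurable, $|E|_{\omega,\alpha}=\int_E\omega\,dV_\alpha$ and $|E|_\alpha=\int_E dV_\alpha$. A Young function is a function $\Phi:[0,\infty)\to[0,\infty)$ that is continuous, convex and increasing,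 with $\Phi(0)=0$ and $\Phi(t)\to\infty$ as $t\to\infty$; throughout, $\Phi(1)=1$. For $1<p<\infty$, $\Phi\in B_p$ means that $\Phi$ is a Young function satisfying the $\Delta_2$ condition (there is $K>1$ with $\Phi(2t)\le K\Phi(t)$ for all $t\ge0$) and there is $c>0$ with $\int_c^\infty\frac{\Phi(t)}{t^p}\frac{dt}{t}<\infty$. Luxembourg norm: $\|f\|_{Q_I,\Phi,\alpha}=\inf\{\lambda>0:\frac{1}{|Q_I|_\alpha}\int_{Q_I}\Phi\left(\frac{|f(z)|}{\lambda}\right)dV_\alpha(z)\le1\}$. Maximal functions: $\mathcal{M}_{\Phi,\alpha}f(z)=\sup\|f\|_{Q_I,\Phi,\alpha}$, the supremum being over all intervals $I\subset\mathbb R$ with $z\in Q_I$; and $\mathcal{M}_\alpha\omega(z)=\sup_{I\subset\mathbb R}\frac{\chi_{Q_I}(z)}{|Q_I|_\alpha}\int_{Q_I}\omega\,dV_\alpha$. *)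

(* Defs.v *)
From HB Require Import structures.
From mathcomp Require Import all_boot all_order all_algebra.
From mathcomp Require Import all_classical all_reals all_analysis.
From mathcomp.real_closed Require Import complex.

Set Implicit Arguments.
Unset Strict Implicit.
Unset Printing Implicit Defensive.

Import Order.TTheory GRing.Theory Num.Theory.
Import numFieldNormedType.Exports.

Local Open Scope classical_set_scope.
Local Open Scope ring_scope.

(* The point x + iy of the complex plane is encoded as the pair (x, y). *)
Definition halfplane (R : realType) : set (R * R) := [set z | 0 < z.2].
Arguments halfplane {R}.

Notation lebesgue2 R :=
  (product_measure1 (@lebesgue_measure R) (@lebesgue_measure R)).

Definition integral_dV (R : realType) (alpha : R) (E : set (R * R))
    (g : R * R -> \bar R) : \bar R :=
  (\int[lebesgue2 R]_(z in E) (g z * (z.2 `^ alpha)%:E))%E.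

Definition area (R : realType) (alpha : R) (E : set (R * R)) : \bar R :=
  integral_dV alpha E (fun=> 1%E).

Definition warea (R : realType) (alpha : R) (omega : R * R -> R)
    (E : set (R * R)) : \bar R :=
  integral_dV alpha E (fun z => (omega z)%:E).

Definition weight (R : realType) (omega : R * R -> R) : Prop :=
  [/\ forall z, halfplane z -> 0 <= omega z,
      measurable_fun halfplane omega
    & forall K : set (R * R), K `<=` halfplane -> compact K ->
        (\int[lebesgue2 R]_(z in K) (omega z)%:E < +oo)%E].

(* Endpoints may or may not belong to I. *)
Definition proper_interval (R : realType) (I : set R) : Prop :=
  [/\ is_interval I, bounded_set I & (0 < lebesgue_measure I)%E].

Definition carleson (R : realType) (I : set R) : set (R * R) :=
  [set z | [/\ I z.1, 0 < z.2 & (z.2%:E < lebesgue_measure I)%E]].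

Definition intervals_at (R : realType) (z : R * R) : set (set R) :=
  [set I | proper_interval I /\ carleson I z].

(* Only the values of Phi on [0, +oo[ matter. *)
Definition young (R : realType) (Phi : R -> R) : Prop :=
  [/\ {within `[0, +oo[, continuous Phi},
      convex_function (`[0, +oo[ : set R^o) Phi,
      {in `[0, +oo[ &, {homo Phi : s t / s <= t}},
      Phi 0 = 0
    & Phi t @[t --> +oo] --> +oo] /\ Phi 1 = 1.

Definition Delta2 (R : realType) (Phi : R -> R) : Prop :=
  exists2 K : R, 1 < K & forall t, 0 <= t -> Phi (2 * t) <= K * Phi t.

Definition Bclass (R : realType) (p : R) (Phi : R -> R) : Prop :=
  [/\ young Phi, Delta2 Phi
    & exists2 c : R, 0 < c &
        (\int[lebesgue_measure]_(t in `]c, +oo[)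
           (Phi t / (t `^ p) / t)%:E < +oo)%E].

(* The infimum is taken in the extended reals: it is +oo if no lambda fits. *)
Definition luxemburg (R : realType) (alpha : R) (Phi : R -> R) (I : set R)
    (f : R * R -> R[i]) : \bar R :=
  ereal_inf [set lambda%:E | lambda in [set lambda : R | 0 < lambda /\
    ((area alpha (carleson I))^-1 *
      integral_dV alpha (carleson I)
        (fun z => (Phi (ComplexField.Normc.normc (f z) / lambda))%:E) <= 1)%E]].

Definition orlicz_maximal (R : realType) (alpha : R) (Phi : R -> R)
    (f : R * R -> R[i]) (z : R * R) : \bar R :=
  ereal_sup [set luxemburg alpha Phi I f | I in intervals_at z].

Definition maximal (R : realType) (alpha : R) (omega : R * R -> R)
    (z : R * R) : \bar R :=
  ereal_sup [set ((\1_(carleson I) z)%:E / area alpha (carleson I) *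
                  warea alpha omega (carleson I))%E
            | I in @proper_interval R].

(* Division in \bar R: a / 0 = +oo for a > 0, and 0 / 0 = +oo / +oo = 0. *)
Definition Kmu (R : realType) (alpha : R) (omega : R * R -> R)
    (mu : {measure set (R * R) -> \bar R}) (z : R * R) : \bar R :=
  ereal_sup [set (mu (carleson I) / warea alpha omega (carleson I))%E
            | I in intervals_at z].

(* Members of L^s are (almost everywhere) finite-valued; the integral
   condition alone does not force this where sigma vanishes. *)
Definition memL (R : realType) (alpha s : R) (sigma : R * R -> \bar R)
    (g : R * R -> \bar R) : Prop :=
  {ae lebesgue2 R, forall z, halfplane z -> g z \is a fin_num} /\
  (integral_dV alpha halfplane (fun z => `|g z| `^ s * sigma z) < +oo)%E.

(* Main.v *)
(* Squares over the intervals of a nested grid form a laminar family A_i, and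
   for a laminar family an inequality between two measures on each A_i passes
   to the integrals of every supremum of functions c_i 1_(A_i).  Two shifted
   triadic grids suffice: every interval lies in a grid interval of comparable
   length, so the maximal function of f is at most a constant times the larger
   of two functions N = sup 2^k 1_(A_i), over the pairs (i, k) such that the
   mean of Phi(|f| / 2^k) over A_i exceeds 1.  Write K for the supremum of
   mu(A_i) / |A_i|_omega and W for that of |A_i|_omega / |A_i|, over the
   squares containing a point, so that K <= K_mu and W <= M omega.  Then
     int N^q dmu <= int N^q K omega <= (int N^p omega)^(q/p) (int K^s omega)^(1/s)
   by laminarity and Hoelder, int K^s omega <= int K^s W by laminarity again,
   and int N^p omega <= C int |f|^p W is a Fefferman-Stein inequality: since
   Phi(1/2) <= 1/2, half of the mean of Phi(|f| / 2^k) comes from the points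
   where |f| > 2^k / 2, and by the B_p condition the contributions of all the
   levels sum up to a multiple of |f|^p. *)
Require Import Defs.
From HB Require Import structures.
From mathcomp Require Import all_boot all_order all_algebra.
From mathcomp Require Import all_classical all_reals all_analysis.
From mathcomp.real_closed Require Import complex.
From mathcomp Require Import measurable_realfun.
From mathcomp Require Import ring lra zify.

Set Implicit Arguments.
Unset Strict Implicit.
Unset Printing Implicit Defensive.

Import Order.TTheory GRing.Theory Num.Theory.
Import numFieldNormedType.Exports.

Local Open Scope classical_set_scope.
Local Open Scope ring_scope.

(** [Kmu], [maximal] and [orlicz_maximal] are suprema over uncountably many intervals, and their
    measurability is never established. They are only compared pointwise with countable suprema over
    grid squares, through the monotonicity of the integral; additivity, monotone convergence and
    Hoelder are applied to the latter. A weight is integrable on compact subsets of the open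
    half-plane, so it may have infinite mass on a square, which touches the real axis. Then M omega
    is infinite everywhere, and either the right-hand side is infinite or f vanishes Lebesgue-almost
    everywhere. In the latter case the maximal function of f is zero at every point, which settles
    the matter even for a singular mu. In the remaining case all masses |Q|_omega are finite, and
    the almost everywhere finiteness of K_mu makes mu(Q) finite, and zero when |Q|_omega is zero;
    the ratios can then be taken as real numbers. *)

Lemma ge0_le_poweR (R : realType) (r : R) (x y : \bar R) :
  ((0 <= r)%R -> 0 <= x -> x <= y -> x `^ r <= y `^ r)%E.
Proof.
move=> r0 x0 xy; have y0 := le_trans x0 xy.
by apply: gt0_ler_poweR; rewrite ?in_itv/= ?x0 ?y0 ?leey.
Qed.

(** * Laminar families and integrals of suprema of weighted indicators *)

Section laminar.
Local Open Scope ereal_scope.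
Context d (T : measurableType d) (R : realType).
Implicit Types (m : {measure set T -> \bar R}) (A : nat -> set T) (c : nat -> R).

(* The integral of a nonnegative function is defined as the supremum of the
   integrals of the simple functions below it; it is thus monotone even on
   functions not known to be measurable, such as [Kmu] and [orlicz_maximal]. *)
Lemma ge0_le_integral_lower m (D : set T) (f g : T -> \bar R) :
  (forall x, D x -> 0 <= f x) -> (forall x, D x -> f x <= g x) ->
  \int[m]_(x in D) f x <= \int[m]_(x in D) g x.
Proof.
move=> f0 fg.
have g0 x : D x -> 0 <= g x by move=> Dx; exact: le_trans (f0 x Dx) (fg x Dx).
rewrite !ge0_integralE//; apply: ge_ereal_sup => _ [h hf <-].
apply: ereal_sup_ubound; exists h => // x; apply: le_trans (hf x) _.
by rewrite /patch; case: ifPn => // /set_mem Dx; exact: fg.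
Qed.

(** Repetitions are allowed: later, indices that differ only in their level carry the same
    square. *)
Definition laminar A := forall i j,
  [\/ A i `<=` A j, A j `<=` A i | A i `&` A j = set0].

Lemma laminar_bigsetU_integral m1 m2 A (g1 g2 : T -> \bar R) (s : seq nat) :
  laminar A -> (forall i, measurable (A i)) ->
  measurable_fun [set: T] g1 -> measurable_fun [set: T] g2 ->
  (forall x, 0 <= g1 x) -> (forall x, 0 <= g2 x) ->
  (forall i, i \in s ->
     \int[m1]_(x in A i) g1 x <= \int[m2]_(x in A i) g2 x) ->
  \int[m1]_(x in \big[setU/set0]_(i <- s) A i) g1 x <=
  \int[m2]_(x in \big[setU/set0]_(i <- s) A i) g2 x.
Proof.
move=> lamA mA mg1 mg2 g10 g20.
have [n] := ubnP (size s); elim: n s => // n IH [|a l] /= sn hA.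
  by rewrite !big_nil !integral_set0.
have [[b bl ab]|nab] := pselect (exists2 b, b \in l & A a `<=` A b).
  rewrite !big_cons.
  have -> : A a `|` \big[setU/set0]_(i <- l) A i = \big[setU/set0]_(i <- l) A i.
    apply: setUidr; apply: subset_trans ab _.
    by rewrite -bigcup_seq; exact: bigcup_sup.
  by apply: IH => // i il; apply: hA; rewrite inE il orbT.
pose l' := [seq i <- l | `[< A a `&` A i = set0 >]].
have -> : \big[setU/set0]_(i <- a :: l) A i =
          A a `|` \big[setU/set0]_(i <- l') A i.
  rewrite big_cons -!bigcup_seq; apply/seteqP; split => x [Aax|[i /= il Aix]].
  - by left.
  - have [ai|ia|ai0] := lamA a i.
    + by exfalso; apply: nab; exists i.
    + by left; exact: ia.
    + by right; exists i => //=; rewrite mem_filter il andbT; exact/asboolP.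
  - by left.
  - by right; exists i => //; move: il; rewrite /= mem_filter => /andP[].
have dj : [disjoint A a & \big[setU/set0]_(i <- l') A i]%classic.
  apply/disj_setPS => x [Aax]; rewrite -bigcup_seq => -[i /=].
  rewrite mem_filter => /andP[/asboolP ai0 _] Aix.
  by suff : (A a `&` A i) x by rewrite ai0.
rewrite !ge0_integral_setU//; try exact: bigsetU_measurable;
  try exact: measurable_funTS.
apply: leeD; first by apply: hA; rewrite mem_head.
apply: IH => [|i].
  by rewrite ltnS in sn; apply: leq_ltn_trans sn; rewrite size_filter count_size.
by rewrite mem_filter => /andP[_ il]; apply: hA; rewrite inE il orbT.
Qed.

Let bmax c A (s : seq nat) (x : T) : R :=
  (\big[Num.max/0]_(i <- s) (c i * \1_(A i) x))%R.

Let bmax_ge0 c A s x : (0 <= bmax c A s x)%R.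
Proof. exact: bigmax_ge_id. Qed.

Let le_bmax c A s i x : i \in s -> (c i * \1_(A i) x <= bmax c A s x)%R.
Proof. by move=> si; exact: (@le_bigmax_seq _ _ _ _ 0%R i xpredT). Qed.

Let bmax_le c A s x (M : R) : (0 <= M)%R ->
  (forall i, i \in s -> (c i * \1_(A i) x <= M)%R) -> (bmax c A s x <= M)%R.
Proof. by move=> M0 h; rewrite /bmax big_seq; apply: bigmax_le. Qed.

Let measurable_bmax c A s : (forall i, measurable (A i)) ->
  measurable_fun [set: T] (bmax c A s).
Proof.
move=> mA; rewrite /bmax; elim: s => [|a l IH].
  by under eq_fun do rewrite big_nil; exact: measurable_cst.
under eq_fun do rewrite big_cons.
by apply: measurable_maxr => //; apply: measurable_funM.
Qed.

(* Peeling off the smallest coefficient [c0] writes the maximum as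
   [c0] times the indicator of the union plus a shorter maximum. *)
Lemma laminar_bigmax_integral m1 m2 A c (g1 g2 : T -> \bar R) (s : seq nat) :
  laminar A -> (forall i, measurable (A i)) ->
  measurable_fun [set: T] g1 -> measurable_fun [set: T] g2 ->
  (forall x, 0 <= g1 x) -> (forall x, 0 <= g2 x) ->
  (forall i, i \in s -> (0 < c i)%R) ->
  (forall i, i \in s ->
     \int[m1]_(x in A i) g1 x <= \int[m2]_(x in A i) g2 x) ->
  \int[m1]_x ((\big[Num.max/0%R]_(i <- s) (c i * \1_(A i) x))%:E * g1 x) <=
  \int[m2]_x ((\big[Num.max/0%R]_(i <- s) (c i * \1_(A i) x))%:E * g2 x).
Proof.
move=> lamA mA mg1 mg2 g10 g20; rewrite -!/(bmax _ _ _ _).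
have [n] := ubnP (size s); elim: n c s => // n IH c s sn c0 hA.
have [->|s0] := eqVneq s [::].
  by rewrite !integral0_eq// => x _; rewrite big_nil mul0e.
have [i0 i0s mini0] : exists2 i, i \in s & forall j, j \in s -> (c i <= c j)%R.
  have sz : (0 < size s)%N by rewrite lt0n size_eq0.
  pose k := [arg min_(k < Ordinal sz) c (nth 0%N s k)]%O.
  exists (nth 0%N s k); first exact: mem_nth.
  move=> j js; rewrite /k; case: arg_minP => // k' _ /(_ (Ordinal _)) h.
  have js' : (index j s < size s)%N by rewrite index_mem.
  by have := h _ js' isT; rewrite /= nth_index.
(* The strict inequality keeps the reduced coefficients [c'] positive and removes [i0], so the list
   gets shorter. *)
pose s' := [seq i <- s | c i0 < c i]%R.
pose c' i := (c i - c i0)%R.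
pose B := \big[setU/set0]_(i <- s) A i.
have mB : measurable B by exact: bigsetU_measurable.
have bE x : bmax c A s x = (c i0 * \1_B x + bmax c' A s' x)%R.
  have [Bx|nBx] := pselect (B x).
    rewrite indicE mem_set// mulr1.
    have [i si Aix] : exists2 i, i \in s & A i x.
      by move: Bx; rewrite /B -bigcup_seq => -[i si Aix]; exists i.
    have hi : (c i0 <= bmax c A s x)%R.
      apply: le_trans (mini0 _ si) _.
      by have := le_bmax c A x si; rewrite indicE mem_set// mulr1.
    apply/eqP; rewrite eq_le; apply/andP; split.
      apply: bmax_le => [|j js].
        by rewrite addr_ge0// ltW// c0.
      rewrite indicE; case: (boolP (x \in A j)) => [/set_mem Ajx|_]; last first.
        by rewrite mulr0 addr_ge0// ltW// c0.
      rewrite mulr1; have := mini0 _ js; rewrite le_eqVlt => /predU1P[<-|lt0].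
        by rewrite lerDl.
      rewrite -lerBlDl; have js' : j \in s' by rewrite mem_filter lt0.
      by have := le_bmax c' A x js'; rewrite indicE mem_set// mulr1.
    rewrite -lerBrDl; apply: bmax_le => [|j]; first by rewrite subr_ge0.
    rewrite mem_filter => /andP[_ js]; rewrite indicE.
    case: (boolP (x \in A j)) => [/set_mem Ajx|_].
      rewrite mulr1 lerD2r.
      by have := le_bmax c A x js; rewrite indicE mem_set// mulr1.
    by rewrite mulr0 subr_ge0.
  rewrite indicE memNset// mulr0 add0r.
  have h i : i \in s -> (\1_(A i) x = 0 :> R)%R.
    move=> si; rewrite indicE memNset// => Aix; apply: nBx.
    by rewrite /B -bigcup_seq; exists i.
  have bmax0 e s1 : {subset s1 <= s} -> bmax e A s1 x = 0%R.
    move=> s1s; apply/eqP; rewrite eq_le bmax_ge0 andbT; apply: bmax_le => // i.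
    by move=> /s1s /h ->; rewrite mulr0.
  rewrite !bmax0// => i; by rewrite mem_filter => /andP[].
have key m (g : T -> \bar R) : measurable_fun [set: T] g -> (forall x, 0 <= g x) ->
    \int[m]_x ((bmax c A s x)%:E * g x) =
    (c i0)%:E * \int[m]_(x in B) g x + \int[m]_x ((bmax c' A s' x)%:E * g x).
  move=> mg g0.
  have ci0 : (0 <= c i0)%R by rewrite ltW// c0.
  rewrite [in X in _ = X + _]integral_mkcond -ge0_integralZl_EFin//; last 2 first.
    by move=> x _; rewrite erestrict_ge0.
    by apply/(measurable_restrictT _ mB); exact: measurable_funTS.
  rewrite -ge0_integralD//.
  - apply: eq_integral => x _; rewrite bE EFinD ge0_muleDl//.
      congr (_ + _); rewrite EFinM -muleA; congr (_ * _).
      by rewrite patchE indicE; case: ifP; rewrite ?mul1e ?mul0e.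
    by rewrite lee_fin mulr_ge0.
    by rewrite lee_fin.
  - by move=> x _; rewrite mule_ge0// ?lee_fin// erestrict_ge0.
  - apply: measurable_funeM.
    by apply/(measurable_restrictT _ mB); exact: measurable_funTS.
  - by move=> x _; rewrite mule_ge0// lee_fin.
  - apply: emeasurable_funM => //; apply/measurable_EFinP.
    exact: measurable_bmax.
rewrite !key//; apply: leeD.
  apply: lee_wpmul2l; first by rewrite lee_fin ltW// c0.
  exact: laminar_bigsetU_integral.
apply: IH => [|i|i].
- rewrite ltnS in sn; apply: leq_trans sn; rewrite size_filter.
  rewrite -(count_predC (fun i => c i0 < c i)%R s) -addn1 leq_add2l.
  by rewrite -has_count; apply/hasP; exists i0 => //=; rewrite ltxx.
- by rewrite mem_filter => /andP[+ _]; rewrite subr_gt0.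
- by rewrite mem_filter => /andP[_]; exact: hA.
Qed.

(** For nonnegative [c] this is the supremum of the [c i] over the sets containing [x], and 0 if
    there is none. *)
Definition indic_sup A c (x : T) : \bar R :=
  ereal_sup (range (fun i => (c i * \1_(A i) x)%:E)).

(** Zero coefficients do not affect the maximum, and the inequality between the measures is assumed
    only where the coefficient is positive. *)
Let support c n := [seq i <- iota 0 n | (0 < c i)%R].

Let bmax_support_nd A c x : nondecreasing_seq (fun n => bmax c A (support c n) x).
Proof.
move=> n k nk; apply: bmax_le => // i; rewrite mem_filter mem_iota => /andP[ci ik].
apply: le_bmax; rewrite mem_filter mem_iota ci/=.
exact: leq_trans nk.
Qed.

Lemma indic_sup_ge A c i x : A i x -> (c i)%:E <= indic_sup A c x.
Proof.
move=> Aix; apply: ereal_sup_ubound; exists i => //.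
by rewrite indicE mem_set// mulr1.
Qed.

Lemma indic_sup_le A c x M : 0 <= M -> (forall i, A i x -> (c i)%:E <= M) ->
  indic_sup A c x <= M.
Proof.
move=> M0 h; apply: ge_ereal_sup => _ [i _ <-]; rewrite indicE.
by case: (boolP (x \in A i)) => [/set_mem /h|_]; rewrite ?mulr1 ?mulr0.
Qed.

Lemma indic_sup_ge0 A c x : (forall i, (0 <= c i)%R) -> 0 <= indic_sup A c x.
Proof.
move=> c0; apply: le_trans (_ : (c 0%N * \1_(A 0%N) x)%:E <= _).
  by rewrite lee_fin mulr_ge0.
by apply: ereal_sup_ubound; exists 0%N.
Qed.

Let bmax_le_indic_sup A c s x : (forall i, (0 <= c i)%R) ->
  (bmax c A s x)%:E <= indic_sup A c x.
Proof.
move=> c0; have := indic_sup_ge0 A x c0.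
have : forall j, (c j * \1_(A j) x)%:E <= indic_sup A c x.
  by move=> j; apply: ereal_sup_ubound; exists j.
case: (indic_sup A c x) => [M hM M0|_ _|_]//; last by rewrite leey.
by rewrite lee_fin; apply: bmax_le => // j _; rewrite -lee_fin hM.
Qed.

Let bmax_support_cvg A c x : (forall i, (0 <= c i)%R) ->
  (bmax c A (support c n) x)%:E @[n --> \oo] --> indic_sup A c x.
Proof.
move=> c0.
have -> : indic_sup A c x =
    ereal_sup (range (fun n => (bmax c A (support c n) x)%:E)).
  apply/eqP; rewrite eq_le; apply/andP; split; apply: ge_ereal_sup => _ [i _ <-].
    have /orP[/eqP<-|ci] : ((0 == c i) || (0 < c i))%R by rewrite -le_eqVlt.
      rewrite mul0r; apply: le_trans (_ : (bmax c A (support c 0) x)%:E <= _).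
        by rewrite lee_fin.
      by apply: ereal_sup_ubound; exists 0%N.
    apply: le_trans (_ : (bmax c A (support c i.+1) x)%:E <= _).
      rewrite lee_fin; apply: le_bmax.
      by rewrite mem_filter mem_iota ci/= add0n.
    by apply: ereal_sup_ubound; exists i.+1.
  exact: bmax_le_indic_sup.
apply: ereal_nondecreasing_cvgn => n k nk.
by rewrite lee_fin; exact: bmax_support_nd.
Qed.

Lemma measurable_indic_sup A c : (forall i, measurable (A i)) ->
  (forall i, (0 <= c i)%R) -> measurable_fun [set: T] (indic_sup A c).
Proof.
move=> mA c0.
apply: (emeasurable_fun_cvg (fun n x => (bmax c A (support c n) x)%:E)).
  by move=> n; apply/measurable_EFinP; exact: measurable_bmax.
by move=> x _; exact: bmax_support_cvg.
Qed.

(** Keeps powers such as N^q and K^s within the scope of the laminar inequality. Both bounds follow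
    from the monotonicity of the powers [r] and [r^-1]. *)
Lemma indic_sup_poweR A c r x : (0 < r)%R -> (forall i, (0 <= c i)%R) ->
  indic_sup A c x `^ r = indic_sup A (fun i => c i `^ r)%R x.
Proof.
move=> r0 c0; have rN0 : r != 0%R by rewrite gt_eqF.
have S0 : 0 <= indic_sup A (fun i => c i `^ r)%R x.
  by apply: indic_sup_ge0 => i; exact: powR_ge0.
apply/eqP; rewrite eq_le; apply/andP; split.
  have -> : indic_sup A (fun i => c i `^ r)%R x =
      (indic_sup A (fun i => c i `^ r)%R x `^ r^-1) `^ r.
    by rewrite -poweRrM mulVf// poweRe1.
  apply: ge0_le_poweR (ltW r0) (indic_sup_ge0 _ _ c0) _.
  apply: indic_sup_le => [|i Aix]; first exact: poweR_ge0.
  have -> : (c i)%:E = ((c i)%:E `^ r) `^ r^-1.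
    by rewrite -poweRrM mulfV// poweRe1// lee_fin.
  apply: ge0_le_poweR; rewrite ?invr_ge0 ?(ltW r0) ?poweR_ge0//.
  exact: (@indic_sup_ge _ (fun i => c i `^ r)%R).
apply: indic_sup_le => [|i Aix]; first exact: poweR_ge0.
rewrite -poweR_EFin; apply: ge0_le_poweR; rewrite ?(ltW r0) ?lee_fin//.
exact: indic_sup_ge.
Qed.

(** By monotone convergence the left side is a limit of integrals of finite maxima; on the right it
    is enough that these maxima lie below the supremum. [g1] is real-valued so that multiplication
    by it preserves limits in the extended reals. *)
Lemma laminar_indic_sup_integral m1 m2 A c (g1 : T -> R) (g2 : T -> \bar R) :
  laminar A -> (forall i, measurable (A i)) ->
  measurable_fun [set: T] g1 -> measurable_fun [set: T] g2 ->
  (forall x, 0 <= g1 x)%R -> (forall x, 0 <= g2 x) -> (forall i, 0 <= c i)%R ->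
  (forall i, (0 < c i)%R ->
     \int[m1]_(x in A i) (g1 x)%:E <= \int[m2]_(x in A i) g2 x) ->
  \int[m1]_x (indic_sup A c x * (g1 x)%:E) <=
  \int[m2]_x (indic_sup A c x * g2 x).
Proof.
move=> lamA mA mg1 mg2 g10 g20 c0 hA.
pose u n x := (bmax c A (support c n) x)%:E * (g1 x)%:E.
have -> : \int[m1]_x (indic_sup A c x * (g1 x)%:E) = \int[m1]_x limn (u ^~ x).
  apply: eq_integral => x _; apply/esym/cvg_lim => //.
  by apply: cvgeZr => //; exact: bmax_support_cvg.
have mu n : measurable_fun [set: T] (u n).
  by apply: emeasurable_funM; apply/measurable_EFinP => //; exact: measurable_bmax.
have u0 n x : setT x -> 0 <= u n x by move=> _; rewrite mule_ge0// lee_fin.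
have ndu x : setT x -> nondecreasing_seq (u ^~ x).
  move=> _ n k nk; apply: lee_wpmul2r; first by rewrite lee_fin.
  by rewrite lee_fin; exact: bmax_support_nd.
rewrite monotone_convergence//; apply: lime_le.
  apply: ereal_nondecreasing_is_cvgn => n k nk.
  by apply: ge0_le_integral => // x _; [exact: u0|exact: ndu].
apply: nearW => n; apply: le_trans.
  apply: (@laminar_bigmax_integral m1 m2 A c (EFin \o g1) g2 (support c n)) => //.
  - exact/measurable_EFinP.
  - by move=> i; rewrite mem_filter => /andP[].
  - by move=> i; rewrite mem_filter => /andP[/hA].
apply: ge0_le_integral => //.
- by move=> x _; apply: mule_ge0 => //; rewrite lee_fin; exact: bmax_ge0.
- by apply: emeasurable_funM => //; apply/measurable_EFinP; exact: measurable_bmax.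
- by apply: emeasurable_funM => //; exact: measurable_indic_sup.
move=> x _; apply: lee_wpmul2r => //.
exact: bmax_le_indic_sup.
Qed.

End laminar.

Lemma exprz_bracket (R : realType) (b x : R) : 1 < b -> 0 < x ->
  exists k : int, b ^ k <= x < b ^ (k + 1).
Proof.
move=> b1 x0; have b0 : 0 < b by exact: lt_trans b1.
have lb : 0 < ln b by exact: ln_gt0.
exists (Num.floor (ln x / ln b)).
have bE (k : int) : b ^ k = expR (k%:~R * ln b).
  by rewrite -powR_intmul ?ltW// /powR gt_eqF.
rewrite !bE -{2 3}(lnK x0) ler_expR ltr_expR -ler_pdivlMr// -ltr_pdivrMr//.
by rewrite floor_le_tmp/= floorD1_gt.
Qed.

(** * Hoelder's inequality for extended nonnegative functions *)

Section hoelder_ereal.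
Local Open Scope ereal_scope.
Context d (T : measurableType d) (R : realType).
Variable m : {measure set T -> \bar R}.

(** Finiteness of the two integrals makes [F] and [G] finite almost everywhere, so their product
    agrees almost everywhere with that of their real parts under [fine]. Since [fine] sends [+oo] to
    0, it can only decrease the norms. *)
Lemma ge0_hoelder (F G : T -> \bar R) (r s : R) :
  measurable_fun [set: T] F -> measurable_fun [set: T] G ->
  (forall x, 0 <= F x) -> (forall x, 0 <= G x) ->
  (0 < r)%R -> (0 < s)%R -> (r^-1 + s^-1 = 1)%R ->
  \int[m]_x (F x `^ r) < +oo -> \int[m]_x (G x `^ s) < +oo ->
  \int[m]_x (F x * G x) <=
  (\int[m]_x (F x `^ r)) `^ r^-1 * (\int[m]_x (G x `^ s)) `^ s^-1.
Proof.
move=> mF mG F0 G0 r0 s0 rs.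
have ae_fin (H : T -> \bar R) (t : R) : measurable_fun [set: T] H ->
    (forall x, 0 <= H x) -> (0 < t)%R -> \int[m]_x (H x `^ t) < +oo ->
    {ae m, forall x, H x \is a fin_num}.
  move=> mH H0 t0 Hfin.
  have iH : m.-integrable setT (fun x => H x `^ t).
    apply/integrableP; split; first exact: measurableT_comp (measurable_poweR _) mH.
    by under eq_integral do rewrite gee0_abs ?poweR_ge0//.
  have := integrable_ae measurableT iH; apply: filterS => x /(_ I).
  case: (H x) (H0 x) => //=; by rewrite gt_eqF.
have fine_le (H : T -> \bar R) (t : R) : measurable_fun [set: T] H ->
    (forall x, 0 <= H x) -> (0 < t)%R ->
    'N[m]_(t%:E)[EFin \o (fine \o H)] <= (\int[m]_x (H x `^ t)) `^ t^-1.
  move=> mH H0 t0; rewrite unlock /=.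
  apply: ge0_le_poweR; first by rewrite invr_ge0 ltW.
    by apply: integral_ge0 => x _; rewrite lee_fin powR_ge0.
  apply: ge0_le_integral_lower => x _; first by rewrite lee_fin powR_ge0.
  rewrite ger0_norm ?fine_ge0//; case: (H x) (H0 x) => //= _.
  by rewrite gt_eqF// leey.
move=> /(ae_fin _ _ mF F0 r0) aF /(ae_fin _ _ mG G0 s0) aG.
have mfF : measurable_fun [set: T] (fine \o F) by exact: measurableT_comp.
have mfG : measurable_fun [set: T] (fine \o G) by exact: measurableT_comp.
apply: (le_trans _ (lee_pmul (Lnorm_ge0 _ _ _) (Lnorm_ge0 _ _ _)
  (fine_le _ _ mF F0 r0) (fine_le _ _ mG G0 s0))).
apply: le_trans (hoelder m mfF mfG r0 s0 rs).
rewrite Lnorm1.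
rewrite (@ge0_ae_eq_integral _ _ _ m setT (fun x => F x * G x)
  (fun x => `|(EFin \o ((fine \o F) \* (fine \o G))%R) x|))//.
- exact: emeasurable_funM.
- apply: measurableT_comp => //; apply/measurable_EFinP; exact: measurable_funM.
- by move=> x _; rewrite mule_ge0.
- apply: filterS2 aF aG => x fF fG _ /=.
  by rewrite ger0_norm ?mulr_ge0 ?fine_ge0// EFinM !fineK.
Qed.

End hoelder_ereal.

(* [S] bounds a dyadic form of the B_p integral; the sum of the terms
   [2^(kp) Phi(a / 2^k)] over the scales [2^k < 2a] reduces to it by writing
   [2^k = 2^(k0 - j)], where [2^k0] is the largest scale. *)
Section scale_sum.
Context (R : realType) (p S : R) (Phi : R -> R).
Hypothesis p0 : 0 < p.
Hypothesis Phi0 : forall t, 0 <= Phi t.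
Hypothesis ndPhi : {homo Phi : s t / s <= t}.
Hypothesis PhiS : forall n,
  \sum_(j < n) (2 ^+ j) `^ (- p) * Phi (2 ^+ j) <= S.

Definition scale_term (a : R) (k : int) : R :=
  if 2 ^ k < 2 * a then (2 ^ k) `^ p * Phi (a / 2 ^ k) else 0.

Lemma scale_term_ge0 a k : 0 <= scale_term a k.
Proof. by rewrite /scale_term; case: ifP => // _; rewrite mulr_ge0// powR_ge0. Qed.

Let b (j : nat) : R := (2 ^+ j) `^ (- p) * Phi (2 ^+ j).

Let b_ge0 j : 0 <= b j. Proof. by rewrite mulr_ge0// powR_ge0. Qed.

Let uniq_sum_le (s : seq nat) : uniq s -> \sum_(j <- s) b j <= S.
Proof.
move=> us; pose N := (\max_(j <- s) j).+1.
apply: le_trans (PhiS N).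
rewrite -(big_mkord xpredT (fun j => b j)) [leRHS](bigID (mem s))/= -[leLHS]addr0.
rewrite lerD ?sumr_ge0// -[leRHS]big_filter.
rewrite (perm_big [seq i <- index_iota 0 N | i \in s])//.
apply: uniq_perm => //; first by rewrite filter_uniq// iota_uniq.
move=> i; rewrite mem_filter mem_index_iota /= andbC.
case: (boolP (i \in s)) => si; last by rewrite andbF.
by rewrite andbT ltnS; apply/esym; exact: (leq_bigmax_seq i si).
Qed.

Lemma scale_sum_le (a : R) (s : seq int) : 0 <= a -> uniq s ->
  \sum_(k <- s) scale_term a k <= (2 * a) `^ p * S.
Proof.
move=> a0 us.
have S0 : 0 <= S by apply: le_trans (PhiS 0); rewrite big_ord0.
have [->|aN0] := eqVneq a 0.
  rewrite big1 ?mulr_ge0 ?powR_ge0// => k _.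
  by rewrite /scale_term mulr0 ltNge exprz_ge0.
have a2 : 0 < 2 * a by rewrite mulr_gt0// lt0r aN0.
have [k0 /andP[k01 k02]] := @exprz_bracket R 2 _ (ltr1n R 2) a2.
pose l := [seq absz (k0 - k) | k <- s & (k <= k0)%R].
have ul : uniq l.
  rewrite map_inj_in_uniq ?filter_uniq// => x y.
  rewrite !mem_filter => /andP[xk _] /andP[yk _]; lia.
apply: le_trans (_ : \sum_(j <- l) (2 * a) `^ p * b j <= _); last first.
  by rewrite -mulr_sumr ler_wpM2l ?powR_ge0// uniq_sum_le.
rewrite /l big_map big_filter [leRHS]big_mkcond/=; apply: ler_sum => k _.
rewrite /scale_term; case: ifPn => [ka|_]; last first.
  by case: ifP => // _; rewrite mulr_ge0// powR_ge0.
have kk0 : (k <= k0)%R.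
  have : (2 : R) ^ k < 2 ^ (k0 + 1) by exact: lt_trans ka k02.
  by rewrite ltr_eXz2l ?ltr1n//; lia.
rewrite kk0 /b; set j := `|k0 - k|%N.
have kE : k = k0 - j%:Z by rewrite /j; lia.
have e2 : (2 : R) ^ k = 2 ^ k0 / 2 ^+ j.
  by rewrite kE expfzDr ?pnatr_eq0// -exprnN.
have z2 : 0 <= (2 : R) ^ k0 by exact: exprz_ge0.
have j2 : 0 < (2 : R) ^+ j by exact: exprn_gt0.
(* The factors compare separately: [2 ^ k0 <= 2 * a] bounds [2 ^ k] by [2 * a / 2 ^+ j], and
   [a < 2 ^ k0] bounds [a / 2 ^ k] by [2 ^+ j]. *)
rewrite mulrA ler_pM ?powR_ge0//.
  have -> : (2 ^+ j : R) `^ (- p) = (2 ^+ j)^-1 `^ p.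
    by rewrite -powR_inv1 ?(ltW j2)// -powRrM mulN1r.
  rewrite e2 [leLHS]powRM// ?invr_ge0 ?(ltW j2)// ler_wpM2r ?powR_ge0//.
  by rewrite ge0_ler_powR ?nnegrE ?(ltW a2) ?(ltW p0).
apply: ndPhi; rewrite e2 invf_div mulrCA ger_pMr// ler_pdivrMr ?exprz_gt0//.
rewrite mul1r -(ler_pM2l (ltr0n R 2)).
by rewrite (le_trans (ltW k02))// expfzDr ?pnatr_eq0// expr1z mulrC.
Qed.

End scale_sum.

(** * A Fefferman-Stein inequality on a laminar family *)

Section fefferman_stein.
Local Open Scope ereal_scope.
Context d (T : measurableType d) (R : realType).
Variables (m : {measure set T -> \bar R}) (A : nat -> set T).
Hypotheses (lamA : laminar A) (mA : forall i, measurable (A i)).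
Variables (u rho : T -> R) (t : nat -> R).
Hypotheses (mu : measurable_fun [set: T] u) (mrho : measurable_fun [set: T] rho).
Hypotheses (u0 : forall x, (0 <= u x)%R) (rho0 : forall x, (0 <= rho x)%R).
Hypothesis t0 : forall i, (0 <= t i)%R.
Hypothesis rhoA : forall i, \int[m]_(x in A i) (rho x)%:E < +oo.
Hypothesis uA : forall i,
  \int[m]_(x in A i) (u x)%:E = (t i)%:E * \int[m]_(x in A i) (rho x)%:E.
Variables (p S : R) (Phi : R -> R).
Hypothesis p0 : (0 < p)%R.
Hypothesis Phi0 : forall s, (0 <= Phi s)%R.
Hypothesis ndPhi : {homo Phi : r s / (r <= s)%R}.
Hypothesis Phi_half : (Phi 2^-1 <= 2^-1)%R.
Hypothesis PhiS : forall n,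
  (\sum_(j < n) (2 ^+ j) `^ (- p) * Phi (2 ^+ j) <= S)%R.
Variable f : T -> R.
Hypotheses (mf : measurable_fun [set: T] f) (f0 : forall x, (0 <= f x)%R).
Variables (c : nat -> R) (kappa : nat -> int).
Hypothesis c0 : forall i, (0 <= c i)%R.
Hypothesis cE : forall i, (0 < c i)%R -> c i = (2 ^ kappa i)%R.
Hypothesis c_avg : forall i, (0 < c i)%R ->
  \int[m]_(x in A i) (rho x)%:E <=
  \int[m]_(x in A i) (Phi (f x / c i) * rho x)%:E.

Let W : T -> \bar R := indic_sup A t.

Let mW : measurable_fun [set: T] W. Proof. exact: measurable_indic_sup. Qed.

Let W0 x : 0 <= W x. Proof. exact: indic_sup_ge0. Qed.

Let mPhi : measurable_fun [set: R] Phi.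
Proof. exact: nondecreasing_measurable. Qed.

Let big_part (l : R) (x : T) : R := if (l < 2 * f x)%R then Phi (f x / l) else 0%R.

Let big_part_ge0 l x : (0 <= big_part l x)%R.
Proof. by rewrite /big_part; case: ifP. Qed.

Let measurable_big_part l : measurable_fun [set: T] (big_part l).
Proof.
apply: measurable_fun_ifT => //.
- by apply: measurable_fun_ltr => //; exact: measurable_funM.
- apply: measurableT_comp => //; exact: measurable_funM.
Qed.

Let rho_le_big_part i : (0 < c i)%R ->
  \int[m]_(x in A i) (rho x)%:E <=
  \int[m]_(x in A i) (2 * big_part (c i) x * rho x)%:E.
Proof.
move=> ci0.
have mr : measurable_fun (A i) (fun x => (rho x)%:E).
  by apply/measurable_EFinP; exact: measurable_funTS.
have mb : measurable_fun (A i) (fun x => (big_part (c i) x * rho x)%:E).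
  by apply/measurable_EFinP/measurable_funTS; exact: measurable_funM.
have b0 x : A i x -> 0 <= (big_part (c i) x * rho x)%:E.
  by move=> _; rewrite lee_fin mulr_ge0.
have step : \int[m]_(x in A i) (rho x)%:E <=
    2^-1%:E * \int[m]_(x in A i) (rho x)%:E +
    \int[m]_(x in A i) (big_part (c i) x * rho x)%:E.
  apply: le_trans (c_avg ci0) _.
  rewrite -ge0_integralZl_EFin ?invr_ge0//; last by move=> x _; rewrite lee_fin.
  rewrite -ge0_integralD//; last 2 first.
    by move=> x _; rewrite lee_fin mulr_ge0// invr_ge0.
    exact: measurable_funeM.
  apply: ge0_le_integral_lower => x _; first by rewrite lee_fin mulr_ge0.
  rewrite -EFinM -EFinD lee_fin -mulrDl ler_wpM2r// /big_part.
  case: ltP => [_|le]; first by rewrite lerDr invr_ge0.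
  rewrite addr0; apply: le_trans Phi_half; apply: ndPhi.
  by rewrite ler_pdivrMr// -(ler_pM2l (ltr0n R 2)) mulrA divff ?mul1r ?pnatr_eq0.
under [leRHS]eq_integral do rewrite -mulrA EFinM.
rewrite ge0_integralZl_EFin//.
(* Half of the mass is subtracted from both sides, which requires the mass of [A i] to be finite. *)
have rfin : \int[m]_(x in A i) (rho x)%:E \is a fin_num.
  by rewrite ge0_fin_numE// integral_ge0// => x _; rewrite lee_fin.
move: step; case: (\int[m]_(x in A i) (big_part (c i) x * rho x)%:E)
    (integral_ge0 m b0) => [y _|_ _|//]; last by rewrite gt0_muley ?leey.
rewrite -(fineK rfin) -!EFinM -EFinD !lee_fin; lra.
Qed.

Let G (k : int) (x : T) : \bar R :=
  (2 * scale_term p Phi (f x) k * rho x)%:E * W x.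

Let G0 k x : 0 <= G k x.
Proof. by rewrite mule_ge0// lee_fin mulr_ge0// mulr_ge0// scale_term_ge0. Qed.

Let scaleE k x : scale_term p Phi (f x) k = ((2 ^ k) `^ p * big_part (2 ^ k) x)%R.
Proof. by rewrite /scale_term /big_part; case: ifP => _; rewrite ?mulr0. Qed.

Let mG k : measurable_fun [set: T] (G k).
Proof.
apply: emeasurable_funM => //; apply/measurable_EFinP/measurable_funM => //.
apply: measurable_funM => //.
under eq_fun do rewrite scaleE.
by apply: measurable_funM.
Qed.

(** Used as coefficients of [indic_sup], these give the indicator of the union of the squares
    selected at level [2 ^ k]. *)
Let layer (k : int) (i : nat) : R := if (0 < c i)%R && (kappa i == k) then 1%R else 0%R.

Let layer0 k i : (0 <= layer k i)%R.
Proof. by rewrite /layer; case: ifP. Qed.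

(** On a selected square the [u]-mass is [t i] times the [rho]-mass, the latter is controlled by
    [big_part], and [t i <= W] lets [t i] enter the integral as [W]. Laminarity passes to the union
    of the layer, whose indicator is then bounded by 1. *)
Let layer_integral k :
  \int[m]_x (((2 ^ k) `^ p)%:E * (indic_sup A (layer k) x * (u x)%:E)) <=
  \int[m]_x G k x.
Proof.
rewrite ge0_integralZl_EFin ?powR_ge0//; last 2 first.
  by move=> x _; rewrite mule_ge0// ?lee_fin// indic_sup_ge0.
  apply: emeasurable_funM; first exact: measurable_indic_sup.
  exact/measurable_EFinP.
pose g x := (2 * big_part (2 ^ k) x * rho x)%:E * W x.
have g0 x : 0 <= g x by rewrite mule_ge0// lee_fin mulr_ge0// mulr_ge0.
have mg : measurable_fun [set: T] g.
  apply: emeasurable_funM => //; apply/measurable_EFinP/measurable_funM => //.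
  exact: measurable_funM.
apply: (@le_trans _ _ (((2 ^ k) `^ p)%:E * \int[m]_x g x)).
  apply: lee_wpmul2l; first by rewrite lee_fin powR_ge0.
  apply: (@le_trans _ _ (\int[m]_x (indic_sup A (layer k) x * g x))).
    apply: laminar_indic_sup_integral => // i; rewrite /layer.
    case: ifPn => [/andP[ci0 /eqP kE] _|_]; last by rewrite ltxx.
    rewrite uA; apply: le_trans (lee_wpmul2l _ (rho_le_big_part ci0)) _.
      by rewrite lee_fin.
    rewrite -ge0_integralZl_EFin//; last 2 first.
      by move=> x _; rewrite lee_fin mulr_ge0// mulr_ge0.
      apply/measurable_EFinP/measurable_funTS/measurable_funM => //.
      exact: measurable_funM.
    apply: ge0_le_integral_lower => x Ax.
      by rewrite mule_ge0 ?lee_fin// mulr_ge0// mulr_ge0.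
    rewrite muleC (cE ci0) kE; apply: lee_wpmul2l.
      by rewrite lee_fin mulr_ge0// mulr_ge0.
    exact: indic_sup_ge.
  apply: ge0_le_integral_lower => x _; first by rewrite mule_ge0// indic_sup_ge0.
  rewrite -[leRHS]mul1e; apply: lee_wpmul2r => //.
  apply: indic_sup_le => // i _; rewrite lee_fin /layer; by case: ifP.
rewrite -ge0_integralZl_EFin ?powR_ge0//.
apply: ge0_le_integral_lower => x _; first by rewrite mule_ge0// lee_fin powR_ge0.
rewrite /g /G scaleE muleA -EFinM le_eqVlt; apply/orP; left; apply/eqP.
by congr (_%:E * _); ring.
Qed.

Lemma laminar_fefferman_stein :
  \int[m]_x (indic_sup A c x `^ p * (u x)%:E) <=
  (4 * 2 `^ p * S)%:E *
    \int[m]_x ((f x `^ p)%:E * (W x * (rho x)%:E)).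
Proof.
have S0 : (0 <= S)%R by apply: le_trans (PhiS 0); rewrite big_ord0.
pose e k x := ((2 ^ k) `^ p)%:E * (indic_sup A (layer k) x * (u x)%:E).
have e0 k x : 0 <= e k x.
  by rewrite mule_ge0 ?lee_fin ?powR_ge0// mule_ge0 ?lee_fin// indic_sup_ge0.
have me k : measurable_fun [set: T] (e k).
  apply: measurable_funeM; apply: emeasurable_funM; first exact: measurable_indic_sup.
  exact/measurable_EFinP.
(* Pairing the scales [n] and [-(n+1)] turns the sum over all integers into an ordinary series. *)
pose E n x := e (Posz n) x + e (Negz n) x.
have E0 n x : 0 <= E n x by rewrite adde_ge0.
have mE n : measurable_fun [set: T] (E n) by exact: emeasurable_funD.
apply: (@le_trans _ _ (\int[m]_x (\sum_(n <oo) E n x))).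
  apply: ge0_le_integral_lower => x _; first by rewrite mule_ge0 ?lee_fin// poweR_ge0.
  rewrite indic_sup_poweR//.
  (* For positive [u x] one divides by it, so that the bound on the supremum can be checked index by
     index. *)
  have [->|ux] := eqVneq (u x) 0%R; first by rewrite mule0 nneseries_ge0.
  have {}ux : (0 < u x)%R by rewrite lt0r ux u0.
  rewrite -lee_pdivlMr//; apply: indic_sup_le => [|i Ax].
    by rewrite mule_ge0 ?nneseries_ge0// lee_fin invr_ge0.
  rewrite lee_pdivlMr//.
  have := c0 i; rewrite le_eqVlt => /orP[/eqP<-|ci0].
    by rewrite powR0 ?gt_eqF// mul0e nneseries_ge0.
  have eE : (c i `^ p)%:E * (u x)%:E <= e (kappa i) x.
    rewrite /e (cE ci0); apply: lee_wpmul2l; first by rewrite lee_fin powR_ge0.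
    rewrite -[leLHS]mul1e; apply: lee_wpmul2r; first by rewrite lee_fin.
    have -> : 1 = (layer (kappa i) i)%:E by rewrite /layer ci0 eqxx.
    exact: indic_sup_ge.
  apply: le_trans eE _.
  have h n : E n x <= \sum_(n <oo) E n x.
    apply: le_trans (nneseries_lim_ge n.+1 _) => //.
    by rewrite big_nat_recr//= leeDr// sume_ge0.
  case: (kappa i) => n; apply: le_trans (h n); rewrite /E.
    by rewrite leeDl.
  by rewrite leeDr.
rewrite integral_nneseries//.
apply: (@le_trans _ _ (\sum_(n <oo) \int[m]_x (G (Posz n) x + G (Negz n) x))).
  apply: lee_nneseries => [n _ _|n _]; first by rewrite integral_ge0.
  rewrite /E !ge0_integralD//.
  by apply: leeD; exact: layer_integral.
rewrite -integral_nneseries//; last 2 first.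
  by move=> n; exact: emeasurable_funD.
  by move=> n x _; rewrite adde_ge0.
rewrite -ge0_integralZl_EFin//; last 3 first.
  by move=> x _; rewrite !mule_ge0// lee_fin// powR_ge0.
  apply: emeasurable_funM.
    apply/measurable_EFinP.
    by apply: (@measurableT_comp _ _ _ _ _ _ (fun y => y `^ p)%R).
  by apply: emeasurable_funM => //; exact/measurable_EFinP.
  by rewrite !mulr_ge0// powR_ge0.
apply: ge0_le_integral_lower => x _.
  by apply: nneseries_ge0 => n _ _; rewrite adde_ge0.
apply: lime_le; first by apply: is_cvg_nneseries => n _ _; rewrite adde_ge0.
apply: nearW => n.
pose h k := scale_term p Phi (f x) k.
have h0 k : (0 <= h k)%R by exact: scale_term_ge0.
have GE k : G k x = (h k)%:E * ((2 * rho x)%:E * W x).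
  by rewrite /G muleA -EFinM; congr (_%:E * _); rewrite /h; ring.
under eq_bigr do rewrite !GE -ge0_muleDl ?lee_fin//.
have Y0 : 0 <= (2 * rho x)%:E * W x by rewrite mule_ge0// lee_fin mulr_ge0.
rewrite -ge0_sume_distrl; last by move=> i _; rewrite -EFinD lee_fin addr_ge0.
apply: (@le_trans _ _ ((2 * ((2 * f x) `^ p * S))%:E * ((2 * rho x)%:E * W x))).
  apply: lee_wpmul2r => //; under eq_bigr do rewrite -EFinD.
  rewrite sumEFin lee_fin big_split/= mulr_natl mulr2n.
  rewrite /index_iota subn0; apply: lerD.
    rewrite -(big_map Posz xpredT h); apply: scale_sum_le => //.
    by rewrite map_inj_uniq ?iota_uniq// => ? ? [].
  rewrite -(big_map Negz xpredT h); apply: scale_sum_le => //.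
  by rewrite map_inj_uniq ?iota_uniq// => ? ? [].
rewrite powRM// (muleC (W x)) !muleA -!EFinM le_eqVlt; apply/orP; left; apply/eqP.
by congr (_%:E * _); ring.
Qed.

End fefferman_stein.

(** * The inequality between two measures on a laminar family *)

Section laminar_maximal.
Local Open Scope ereal_scope.
Context d (T : measurableType d) (R : realType).
Variables (m nu : {measure set T -> \bar R}) (A : nat -> set T).
Hypotheses (lamA : laminar A) (mA : forall i, measurable (A i)).
Variables (u rho : T -> R).
Hypotheses (mu : measurable_fun [set: T] u) (mrho : measurable_fun [set: T] rho).
Hypotheses (u0 : forall x, (0 <= u x)%R) (rho0 : forall x, (0 <= rho x)%R).
Let aU i := \int[m]_(x in A i) (u x)%:E.
Let aR i := \int[m]_(x in A i) (rho x)%:E.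
Hypothesis aR_gt0 : forall i, 0 < aR i.
Hypothesis aR_fin : forall i, aR i < +oo.
Hypothesis aU_fin : forall i, aU i < +oo.
Hypothesis nu_fin : forall i, nu (A i) < +oo.
Hypothesis nu_ac : forall i, aU i = 0 -> nu (A i) = 0.

Definition weight_ratio i : R :=
  (fine (\int[m]_(x in A i) (u x)%:E) / fine (\int[m]_(x in A i) (rho x)%:E))%R.
(** The real quotient is 0 when the [u]-mass of [A i] vanishes. By [nu_ac], [nu (A i)] is then zero
    too, so [nuE] holds at every index. *)
Definition measure_ratio i : R :=
  (fine (nu (A i)) / fine (\int[m]_(x in A i) (u x)%:E))%R.

Let t := weight_ratio.
Let k := measure_ratio.
Let W : T -> \bar R := indic_sup A t.
Let K : T -> \bar R := indic_sup A k.

Let aU0 i : 0 <= aU i. Proof. by apply: integral_ge0 => x _; rewrite lee_fin. Qed.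

Let t0 i : (0 <= t i)%R.
Proof. by apply: divr_ge0; apply: fine_ge0; [exact: aU0|exact: ltW (aR_gt0 i)]. Qed.

Let k0 i : (0 <= k i)%R.
Proof. by apply: divr_ge0; apply: fine_ge0; [|exact: aU0]. Qed.

Let aUE i : aU i = (t i)%:E * aR i.
Proof.
have aRf : aR i \is a fin_num by rewrite gt0_fin_numE.
have aUf : aU i \is a fin_num by rewrite ge0_fin_numE.
rewrite -(fineK aRf) -EFinM /t /weight_ratio -mulrA mulVf ?mulr1 ?fineK//.
by rewrite gt_eqF// fine_gt0// aR_gt0 aR_fin.
Qed.

Let nuE i : nu (A i) = (k i)%:E * aU i.
Proof.
have nuf : nu (A i) \is a fin_num by rewrite ge0_fin_numE.
have aUf : aU i \is a fin_num by rewrite ge0_fin_numE.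
have [/[dup]/nu_ac -> ->|aUN0] := eqVneq (aU i) 0; first by rewrite mule0.
rewrite -(fineK aUf) -EFinM /k /measure_ratio -mulrA mulVf ?mulr1 ?fineK//.
by rewrite gt_eqF// fine_gt0// aU_fin lt0e aUN0 aU0.
Qed.

Let mW : measurable_fun [set: T] W. Proof. exact: measurable_indic_sup. Qed.
Let mK : measurable_fun [set: T] K. Proof. exact: measurable_indic_sup. Qed.
Let W0 x : 0 <= W x. Proof. exact: indic_sup_ge0. Qed.
Let K0 x : 0 <= K x. Proof. exact: indic_sup_ge0. Qed.

Let muE : measurable_fun [set: T] (EFin \o u). Proof. exact/measurable_EFinP. Qed.
Let mrhoE : measurable_fun [set: T] (EFin \o rho). Proof. exact/measurable_EFinP. Qed.

Variables (p q S : R) (Phi : R -> R).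
Hypotheses (q0 : (0 < q)%R) (qp : (q < p)%R).
Hypothesis Phi0 : forall s, (0 <= Phi s)%R.
Hypothesis ndPhi : {homo Phi : r s / (r <= s)%R}.
Hypothesis Phi_half : (Phi 2^-1 <= 2^-1)%R.
Hypothesis PhiS : forall n,
  (\sum_(j < n) (2 ^+ j) `^ (- p) * Phi (2 ^+ j) <= S)%R.
Let s := (p / (p - q))%R.
Variable B : R.
Hypothesis B0 : (0 < B)%R.
Hypothesis KB : \int[m]_x (K x `^ s * (W x * (rho x)%:E)) <= B%:E.
Variable f : T -> R.
Hypotheses (mf : measurable_fun [set: T] f) (f0 : forall x, (0 <= f x)%R).
Variables (c : nat -> R) (kappa : nat -> int).
Hypothesis c0 : forall i, (0 <= c i)%R.
Hypothesis cE : forall i, (0 < c i)%R -> c i = (2 ^ kappa i)%R.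
Hypothesis c_avg : forall i, (0 < c i)%R ->
  \int[m]_(x in A i) (rho x)%:E <=
  \int[m]_(x in A i) (Phi (f x / c i) * rho x)%:E.

Let N : T -> \bar R := indic_sup A c.
Let N0 x : 0 <= N x. Proof. exact: indic_sup_ge0. Qed.
Let mN : measurable_fun [set: T] N. Proof. exact: measurable_indic_sup. Qed.

Let s0 : (0 < s)%R.
Proof. by rewrite divr_gt0 ?subr_gt0// (lt_trans q0). Qed.

(** On each square [nu (A i) = k i * aU i], and [k i <= K] on [A i] lets the constant enter the
    integral as [K]. The same exchange with [t i <= W] gives [K_weight]. *)
Let nu_to_weight :
  \int[nu]_x (N x `^ q) <= \int[m]_x (N x `^ q * (K x * (u x)%:E)).
Proof.
under eq_integral do rewrite indic_sup_poweR//.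
under [leRHS]eq_integral do rewrite indic_sup_poweR//.
rewrite -[leLHS](@eq_integral _ _ _ nu _ _
  (fun x => indic_sup A (fun i => c i `^ q)%R x * (cst 1%R x)%:E)); last first.
  by move=> x _; rewrite mule1.
apply: (@laminar_indic_sup_integral _ _ _ nu m A _ (cst 1%R)) => //.
- exact: emeasurable_funM.
- by move=> x; rewrite mule_ge0// lee_fin.
- by move=> i; rewrite powR_ge0.
move=> i _.
rewrite [leLHS](_ : _ = nu (A i)); last by rewrite -[RHS]mul1e -integral_cst.
rewrite nuE /aU.
rewrite -ge0_integralZl_EFin//; last 2 first.
  by move=> x _; rewrite lee_fin.
  exact: measurable_funTS.
apply: ge0_le_integral_lower => x Ax; first by rewrite mule_ge0// lee_fin.
by apply: lee_wpmul2r; [rewrite lee_fin|exact: indic_sup_ge].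
Qed.

Let K_weight : \int[m]_x (K x `^ s * (u x)%:E) <= B%:E.
Proof.
apply: le_trans KB.
under eq_integral do rewrite indic_sup_poweR//.
under [leRHS]eq_integral do rewrite indic_sup_poweR//.
apply: laminar_indic_sup_integral => //.
- exact: emeasurable_funM.
- by move=> x; rewrite mule_ge0// lee_fin.
- by move=> i; rewrite powR_ge0.
move=> i _; rewrite -/(aU i) aUE /aR -ge0_integralZl_EFin//; last 2 first.
  by move=> x _; rewrite lee_fin.
  exact: measurable_funTS.
apply: ge0_le_integral_lower => x Ax; first by rewrite mule_ge0// lee_fin.
by apply: lee_wpmul2r; [rewrite lee_fin|exact: indic_sup_ge].
Qed.

Lemma laminar_maximal_integral :
  \int[nu]_x (N x `^ q) <=
  ((4 * 2 `^ p * S)%:E * \int[m]_x ((f x `^ p)%:E * (W x * (rho x)%:E))) `^ (q / p)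
  * (B `^ s^-1)%:E.
Proof.
have p0 : (0 < p)%R by exact: lt_trans qp.
apply: le_trans nu_to_weight _.
have FS := laminar_fefferman_stein lamA mA mu mrho u0 rho0 t0 aR_fin aUE p0 Phi0
  ndPhi Phi_half PhiS mf f0 c0 cE c_avg.
move: FS; rewrite -/W; set X := _ * integral _ _ _; rewrite -/N => FS.
have qp0 : (0 < q / p)%R by rewrite divr_gt0.
(* An infinite bound is trivial because [B] is positive; a finite one supplies the integrability
   that Hoelder requires. *)
have [Xoo|Xfin] := eqVneq X +oo.
  by rewrite Xoo poweRyr ?gt_eqF// gt0_mulye ?leey// lte_fin powR_gt0.
have {}Xfin : X < +oo by rewrite lt_neqAle Xfin leey.
set r := (p / q)%R.
have r0 : (0 < r)%R by rewrite divr_gt0.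
have rs : (r^-1 + s^-1 = 1)%R.
  rewrite /r /s !invf_div -mulrDl addrCA subrr addr0 divff//; exact: lt0r_neq0.
(* Splitting [u] as [u^(1/r) * u^(1/s)] reduces Hoelder with respect to the weighted measure to
   Hoelder with respect to [m]. *)
pose F x := N x `^ q * (u x `^ r^-1)%:E.
pose G x := K x * (u x `^ s^-1)%:E.
have FE x : F x `^ r = N x `^ p * (u x)%:E.
  rewrite /F poweRM ?poweR_ge0 ?lee_fin ?powR_ge0// -poweRrM poweR_EFin -powRrM.
  by rewrite mulVf ?gt_eqF// powRr1// /r mulrCA divff ?gt_eqF// mulr1.
have GE x : G x `^ s = K x `^ s * (u x)%:E.
  rewrite /G poweRM ?lee_fin ?powR_ge0// poweR_EFin -powRrM.
  by rewrite mulVf ?gt_eqF// powRr1.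
have FG x : N x `^ q * (K x * (u x)%:E) = F x * G x.
  rewrite /F /G muleACA -EFinM -powRD ?rs ?powRr1 ?muleA//.
  by rewrite oner_eq0.
under eq_integral do rewrite FG.
have mup e : measurable_fun [set: T] (fun x => (u x `^ e)%:E).
  apply/measurable_EFinP.
  by apply: (@measurableT_comp _ _ _ _ _ _ (fun y => y `^ e)%R).
have mF : measurable_fun [set: T] F.
  apply: emeasurable_funM => //.
  exact: (measurableT_comp (measurable_poweR q) mN).
have mG : measurable_fun [set: T] G by exact: emeasurable_funM.
apply: le_trans (ge0_hoelder mF mG _ _ r0 s0 rs _ _) _.
- by move=> x; rewrite mule_ge0 ?poweR_ge0// lee_fin powR_ge0.
- by move=> x; rewrite mule_ge0// lee_fin powR_ge0.
- by under eq_integral do rewrite FE; exact: le_lt_trans Xfin.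
- by under eq_integral do rewrite GE; rewrite (le_lt_trans K_weight) ?ltry.
under eq_integral do rewrite FE.
under [X in _ * X `^ _]eq_integral do rewrite GE.
rewrite {1}/r invf_div; apply: lee_pmul; rewrite ?poweR_ge0//.
  apply: ge0_le_poweR => //; first exact: ltW.
  by apply: integral_ge0 => x _; rewrite mule_ge0 ?poweR_ge0// lee_fin.
rewrite -poweR_EFin; apply: ge0_le_poweR => //; first by rewrite invr_ge0 ltW.
by apply: integral_ge0 => x _; rewrite mule_ge0 ?poweR_ge0// lee_fin.
Qed.

End laminar_maximal.

(** * Young functions and the dyadic form of the B_p condition *)

Section young_function.
Context (R : realType) (Phi : R -> R).
Hypothesis yPhi : young Phi.

(* [Phi] is only constrained on [0, +oo[; this extension is monotone on the
   whole line, hence measurable. *)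
Definition young_ext (t : R) : R := Phi (Num.max t 0).

Lemma young_extE t : 0 <= t -> young_ext t = Phi t.
Proof. by move=> t0; rewrite /young_ext max_l. Qed.

Lemma young_ext_nd : {homo young_ext : s t / s <= t}.
Proof.
case: yPhi => -[_ _ nd _ _] _ s t st; apply: nd.
- by rewrite in_itv/= andbT le_max lexx orbT.
- by rewrite in_itv/= andbT le_max lexx orbT.
- by rewrite ge_max !le_max st lexx orbT.
Qed.

Lemma young_ext_ge0 t : 0 <= young_ext t.
Proof.
have P0 : Phi 0 = 0 by case: yPhi => -[].
apply: le_trans (_ : young_ext (Num.min t 0) <= _).
  by rewrite /young_ext max_r ?P0// ge_min lexx orbT.
by apply: young_ext_nd; rewrite ge_min lexx.
Qed.

(** Convexity on the segment from 0 to [t], where the value at 0 is zero. *)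
Lemma young_ext_scale (l t : R) : 0 <= l <= 1 -> 0 <= t ->
  young_ext (l * t) <= l * young_ext t.
Proof.
move=> /andP[l0 l1] t0; case: yPhi => -[_ cvx _ P0 _] _.
rewrite !young_extE ?mulr_ge0//.
have h : Phi (l * t + (1 - l) * 0) <= l * Phi t + (1 - l) * Phi 0.
  by apply: (cvx (Itv01 l0 l1)); rewrite inE/= in_itv/= ?t0 ?lexx.
by rewrite P0 !mulr0 !addr0 in h.
Qed.

Lemma young_ext_half : young_ext 2^-1 <= 2^-1.
Proof.
have P1 : young_ext 1 = 1 by rewrite young_extE//; case: yPhi.
have := @young_ext_scale 2^-1 1; rewrite mulr1 P1 mulr1; apply => //.
by apply/andP; split; lra.
Qed.

(** By monotonicity of [Phi], the integral over [[2^j, 2^(j+1)[] is at least a fixed multiple of the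
    term of index [j], and these intervals are disjoint. *)
Lemma Bclass_scale_sum p : 0 < p -> Bclass p Phi ->
  exists S : R, forall n,
    \sum_(j < n) (2 ^+ j) `^ (- p) * young_ext (2 ^+ j) <= S.
Proof.
move=> p0 [_ _ [c c0 hI]].
have two0 j : 0 < (2 : R) ^+ j by exact: exprn_gt0.
pose g t : \bar R := (young_ext t * t `^ (- p) * t `^ (-1))%:E.
pose I := (\int[lebesgue_measure]_(t in `]c, +oo[) g t)%E.
have g0 t : (0 < t)%R -> (0 <= g t)%E.
  by move=> tp; rewrite lee_fin !mulr_ge0 ?powR_ge0 ?young_ext_ge0.
have mg D : measurable_fun D g.
  apply/measurable_EFinP; apply: (@measurable_funS _ _ _ _ setT) => //.
  apply: measurable_funM; first apply: measurable_funM.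
  - exact: nondecreasing_measurable young_ext_nd.
  - exact: measurable_powR.
  - exact: measurable_powR.
have Ifin : (I < +oo)%E.
  apply: le_lt_trans hI; rewrite le_eqVlt; apply/orP; left; apply/eqP.
  apply: eq_integral => y; rewrite inE/= in_itv/= andbT => cy.
  have y0 : 0 <= y by rewrite ltW// (lt_trans c0).
  by rewrite /g young_extE// powRN powR_inv1.
have I0 : (0 <= I)%E.
  apply: integral_ge0 => y /=; rewrite in_itv/= andbT => cy.
  by apply: g0; exact: lt_trans cy.
(* The integral starts at [c], so it controls the terms from [j0] on; the earlier ones form a finite
   sum, added to [S] at the end. *)
have [j0 cj0] : exists j, c < 2 ^+ j.
  exists (Num.truncn c).+1; apply: lt_trans (truncnS_gt c) _.
  by rewrite -natrX ltr_nat ltn_expl.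
pose b j : R := (2 ^+ j) `^ (- p) * young_ext (2 ^+ j).
have b0 j : 0 <= b j by rewrite mulr_ge0 ?powR_ge0 ?young_ext_ge0.
(* On [[2^j, 2^(j+1)[] the factor [t^-p] costs at most [2^-p] relative to its value at [2^j], and
   [1/t] is at least [2^-(j+1)] on a length [2^j], which gives the remaining 1/2. *)
pose e : R := 2^-1 `^ p / 2.
have e0 : 0 < e by rewrite divr_gt0// powR_gt0// invr_gt0.
pose P (i j : nat) : set R := `[2 ^+ i, 2 ^+ j[%classic.
have mP i j : measurable (P i j) by exact: measurable_itv.
have piece j : ((e * b j)%:E <=
    \int[lebesgue_measure]_(y in P j j.+1) g y)%E.
  apply: le_trans (_ : (\int[lebesgue_measure]_(y in P j j.+1)
     (e * b j / 2 ^+ j)%:E <= _)%E).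
    rewrite /P integral_cst//= lebesgue_measure_itv/= lte_fin ltr_eXn2l ?ltr1n// ltnSn.
    rewrite -EFinD -EFinM lee_fin exprS.
    rewrite (_ : 2 * 2 ^+ j - 2 ^+ j = 2 ^+ j); last by ring.
    by rewrite divfK// gt_eqF.
  apply: ge0_le_integral_lower => y /=.
    move=> _; rewrite lee_fin divr_ge0 ?mulr_ge0 ?(ltW e0) ?(ltW (two0 _))//.
    exact: young_ext_ge0.
  rewrite /P/= in_itv/= => /andP[y1 y2]; rewrite lee_fin.
  have y0 : 0 < y by exact: lt_le_trans y1.
  rewrite powRN powR_inv1 ?(ltW y0)//.
  have -> : e * b j / 2 ^+ j = young_ext (2 ^+ j) * ((2 ^+ j.+1) `^ p)^-1 * (2 ^+ j.+1)^-1.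
    have h1 : (2 ^+ j.+1 : R) `^ (- p) = 2^-1 `^ p * (2 ^+ j) `^ (- p).
      rewrite exprS powRM ?(ltW (two0 _))//; congr (_ * _).
      by rewrite -powR_inv1// -powRrM mulN1r.
    by rewrite /e /b -powRN h1 exprS invfM; ring.
  rewrite ler_pM ?mulr_ge0 ?invr_ge0 ?powR_ge0 ?young_ext_ge0 ?(ltW (two0 _))//.
    rewrite ler_pM ?invr_ge0 ?powR_ge0 ?young_ext_ge0 ?young_ext_nd//.
    rewrite lef_pV2 ?posrE ?powR_gt0//.
    by rewrite ge0_ler_powR ?nnegrE ?(ltW p0) ?(ltW y0) ?(ltW y2) ?(ltW (two0 _)).
  by rewrite lef_pV2 ?posrE// ltW.
have sumI n : ((e * \sum_(i < n) b (j0 + i)%N)%:E <=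
    \int[lebesgue_measure]_(y in P j0 (j0 + n)%N) g y)%E.
  elim: n => [|n IH].
    rewrite big_ord0 mulr0; apply: integral_ge0 => y /=.
    by rewrite /P/= in_itv/= => /andP[y1 _]; apply: g0; exact: lt_le_trans y1.
  rewrite big_ord_recr/= mulrDr EFinD.
  have -> : P j0 (j0 + n.+1)%N =
     P j0 (j0 + n)%N `|`
     P (j0 + n)%N (j0 + n).+1.
    rewrite /P addnS -itv_bndbnd_setU// bnd_simp ler_weXn2l// ?ler1n//.
    by rewrite leq_addr.
  rewrite ge0_integral_setU//=; last 5 first.
    exact: mP.
    exact: mP.
    exact: mg.
    move=> y [] /=; rewrite /P/= in_itv/= => /andP[y1 _]; apply: g0; exact: lt_le_trans y1.
    apply/disj_setPS => y [] /=; rewrite /P/= !in_itv/= => /andP[_ h1] /andP[h2 _].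
    by move: (lt_le_trans h1 h2); rewrite ltxx.
  exact: leeD.
have sumI' n : \sum_(i < n) b (j0 + i)%N <= fine I / e.
  rewrite ler_pdivlMr// mulrC -lee_fin fineK ?ge0_fin_numE//.
  apply: le_trans (sumI n) _.
  apply: ge0_subset_integral; [exact: mP|exact: measurable_itv|exact: mg| |].
    by move=> y /=; rewrite in_itv/= andbT => cy; apply: g0; exact: lt_trans cy.
  move=> y /=; rewrite /P/= !in_itv/= andbT => /andP[y1 _]; exact: lt_le_trans y1.
exists (\sum_(j < j0) b j + fine I / e) => n.
apply: le_trans (_ : \sum_(j < j0 + n) b j <= _).
  rewrite addnC big_split_ord/= lerDl sumr_ge0//.
by rewrite big_split_ord/= lerD2l; exact: sumI'.
Qed.

End young_function.

(** * Integrals of powers and areas of Carleson squares *)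

Section power_integral.
Context {R : realType}.

Lemma integral_powR_itv (a b L : R) : 0 < a -> a < L -> b + 1 != 0 ->
  (\int[lebesgue_measure]_(y in `[a, L]) (y `^ b)%:E =
   (L `^ (b + 1) / (b + 1))%:E - (a `^ (b + 1) / (b + 1))%:E)%E.
Proof.
move=> a0 aL b1; pose F (y : R) : R := y `^ (b + 1) / (b + 1).
have pos (y : R) : y \in `[a, L] -> 0 < y.
  by rewrite in_itv/= => /andP[ay _]; exact: lt_le_trans ay.
have dF (y : R) : 0 < y -> is_derive y 1 F (y `^ b).
  move=> y0.
  have -> : F = (b + 1)^-1 \*: ((@powR R) ^~ (b + 1) : R -> R^o).
    by apply/funext => z; rewrite /F mulrC.
  have -> : y `^ b = (b + 1)^-1 *: ((b + 1) * y `^ (b + 1 - 1) : R^o).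
    by rewrite addrK /GRing.scale/= mulrA mulVf// mul1r.
  by apply: is_deriveZ; exact: is_derive1_powR.
have cF (y : R) : 0 < y -> {for y, continuous F}.
  move=> y0; apply: differentiable_continuous; apply/derivable1_diffP.
  by have [] := dF _ y0.
apply: (@continuous_FTC2 R (fun y => y `^ b) F) => //.
- apply: derivable_within_continuous => y /pos y0.
  by apply: derivable_powR; rewrite in_itv/= y0.
- split.
  + move=> y yaL; have /dF[] // : 0 < y.
    by apply: pos; exact: subset_itv_oo_cc yaL.
  + by apply: cvg_at_right_filter; exact: cF.
  + by apply: cvg_at_left_filter; apply: cF; exact: lt_trans aL.
- move=> y yaL; have y0 : 0 < y by apply: pos; exact: subset_itv_oo_cc yaL.
  by rewrite derive1E; have [_ ->] := dF _ y0.
Qed.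

(** For negative [b] the integrand is unbounded at 0, so []0, L]] is exhausted by intervals
    [[a n, L]]; the boundary term at [a n] tends to 0 because [b + 1] is positive. *)
Lemma integral_powR_itv0 (b L : R) : 0 < L -> -1 < b ->
  (\int[lebesgue_measure]_(y in `]0%R, L[) (y `^ b)%:E =
   (L `^ (b + 1) / (b + 1))%:E)%E.
Proof.
move=> L0 b1; have b10 : 0 < b + 1 by lra.
have mb (D : set R) : measurable_fun D (fun y : R => (y `^ b)%:E).
  by apply/measurable_EFinP/measurable_funTS; exact: measurable_powR.
rewrite -(integral_itv_bndoo false false (mb _)).
(* The factor 1/2 makes [a n < L] already for [n = 0], where [harmonic] equals 1. *)
pose a n : R := L / 2 * harmonic n.
have L2 : 0 < L / 2 by rewrite divr_gt0.
have a0 n : 0 < a n by rewrite mulr_gt0// harmonic_gt0.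
have aL n : a n < L.
  apply: le_lt_trans (_ : L / 2 < L); last by rewrite ltr_pdivrMr// ltr_pMr// ltr1n.
  by rewrite ler_piMr ?(ltW L2)// invf_le1// ler1n.
have -> : `]0, L]%classic = \bigcup_n `[a n, L]%classic :> set R.
  apply/seteqP; split => y /=.
    rewrite in_itv/= => /andP[y0 yL].
    exists (Num.truncn (L / 2 / y)) => //=; rewrite in_itv/= yL andbT /a/=.
    rewrite ler_pdivrMr// [leRHS]mulrC -ler_pdivrMr//.
    exact: ltW (truncnS_gt _).
  by move=> [n _] /=; rewrite !in_itv/= => /andP[ay ->]; rewrite (lt_le_trans (a0 n) ay).
have h1 : (\int[lebesgue_measure]_(y in `[a n, L]) (y `^ b)%:E @[n --> \oo] -->
    \int[lebesgue_measure]_(y in \bigcup_n `[a n, L]%classic) (y `^ b)%:E)%E.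
  apply: ge0_nondecreasing_set_cvg_integral.
  - move=> n k nk; apply/subsetPset => y /=; rewrite !in_itv/= => /andP[ay ->].
    rewrite andbT (le_trans _ ay)// /a ler_wpM2l ?(ltW L2)//.
    by rewrite lef_pV2 ?posrE// ler_nat.
  - by move=> n; exact: measurable_itv.
  - by move=> n; exact: mb.
  - by move=> n y _; rewrite lee_fin powR_ge0.
have h2 : (\int[lebesgue_measure]_(y in `[a n, L]) (y `^ b)%:E @[n --> \oo] -->
    (L `^ (b + 1) / (b + 1))%:E)%E.
  under eq_fun do rewrite integral_powR_itv// ?gt_eqF// -EFinB.
  apply: cvg_EFin; first by near=> n.
  rewrite -[X in _ --> X]subr0; apply: cvgB; first exact: cvg_cst.
  rewrite -[X in _ --> X](mul0r (b + 1)^-1); apply: cvgMl.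
  have /cvg_at_rightP := @powR_cvg0 R _ b10; apply; split => // .
  rewrite -[X in _ --> X](mulr0 (L / 2)); apply: cvgMr; exact: cvg_harmonic.
exact: (cvg_unique _ h1 h2).
Unshelve. all: by end_near. Qed.

End power_integral.

Section carleson_squares.
Context {R : realType}.
Implicit Types (I J : set R).

Lemma proper_interval_measure I : proper_interval I ->
  exists2 L : R, 0 < L & lebesgue_measure I = L%:E.
Proof.
move=> [itvI [M [_ bndI]] I0].
have mI : measurable I by exact: is_interval_measurable.
have Ifin : (lebesgue_measure I < +oo)%E.
  pose N := `|M| + 1.
  apply: (@le_lt_trans _ _ (lebesgue_measure (`[- N, N]%classic : set R))).
    apply: le_measure; rewrite ?inE//.
    move=> x /bndI h /=; rewrite in_itv/= -ler_norml; apply: h.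
    by rewrite /N (le_lt_trans (ler_norm M))// ltrDl.
  by rewrite lebesgue_measure_itv/=; case: ifP => _; rewrite -?EFinB ltry.
exists (fine (lebesgue_measure I)); first by rewrite fine_gt0// I0.
by rewrite fineK// gt0_fin_numE.
Qed.

Lemma carlesonE I (L : R) : lebesgue_measure I = L%:E ->
  carleson I = I `*` `]0, L[%classic.
Proof.
move=> IL; apply/seteqP; split => z /=; rewrite /carleson/= IL lte_fin in_itv/=.
  by move=> [Iz -> ->].
by move=> [Iz /andP[-> ->]].
Qed.

Lemma measurable_carleson I : proper_interval I -> measurable (carleson I).
Proof.
move=> pI; have [L _ IL] := proper_interval_measure pI.
case: pI => itvI _ _; rewrite (carlesonE IL); apply: measurableX => //.
exact: is_interval_measurable.
Qed.

Lemma carleson_halfplane I : carleson I `<=` halfplane.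
Proof. by move=> z []. Qed.

Lemma carleson_mono I J : proper_interval I -> proper_interval J -> I `<=` J ->
  carleson I `<=` carleson J.
Proof.
move=> [itvI _ _] [itvJ _ _] IJ z [Iz z0 zI]; split=> //; first exact: IJ.
by apply: lt_le_trans zI _; apply: le_measure; rewrite ?inE//;
  exact: is_interval_measurable.
Qed.

Lemma measurable_snd_powR (alpha : R) :
  measurable_fun [set: R * R] (fun z : R * R => z.2 `^ alpha).
Proof.
exact: (@measurableT_comp _ _ _ _ _ _ (fun y => y `^ alpha)).
Qed.

Lemma area_carleson (alpha : R) I (L : R) : -1 < alpha -> measurable I ->
  0 < L -> lebesgue_measure I = L%:E ->
  area alpha (carleson I) = (L * (L `^ (alpha + 1) / (alpha + 1)))%:E.
Proof.
move=> alpha1 mI L0 IL; rewrite /area /integral_dV (carlesonE IL).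
set V := L `^ (alpha + 1) / (alpha + 1).
have V0 : 0 <= V by rewrite divr_ge0 ?powR_ge0//; lra.
pose g (z : R * R) : \bar R :=
  ((\1_I z.1)%:E * ((\1_(`]0%R, L[%classic : set R) z.2)%:E * (z.2 `^ alpha)%:E))%E.
have mg : measurable_fun [set: R * R] g.
  apply: emeasurable_funM.
    apply/measurable_EFinP.
    by apply: (measurableT_comp (measurable_indic mI)).
  apply: emeasurable_funM; apply/measurable_EFinP; last exact: measurable_snd_powR.
  by apply: (measurableT_comp (measurable_indic _)).
have g0 z : (0 <= g z)%E by rewrite !mule_ge0// lee_fin powR_ge0.
rewrite integral_mkcond [LHS](_ : _ = \int[lebesgue2 R]_z g z)%E; last first.
  apply: eq_integral => z _; rewrite patchE /g mul1e.
  rewrite (_ : (z \in _ `*` _) = (z.1 \in I) && (z.2 \in `]0, L[%classic)).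
    by rewrite !indicE; case: (z.1 \in I); rewrite ?mul0e//= ?mul1e;
      case: (z.2 \in _); rewrite ?mul0e ?mul1e.
  by apply/idP/andP; rewrite !inE.
rewrite fubini_tonelli1// /fubini_F.
transitivity (\int[lebesgue_measure]_x ((V%:E * (\1_I x)%:E))%E)%E.
  apply: eq_integral => x _; rewrite /g/=.
  rewrite ge0_integralZl_EFin//; last first.
    by apply: emeasurable_funM; exact/measurable_EFinP.
    by move=> y _; rewrite mule_ge0// lee_fin powR_ge0.
  rewrite muleC; congr (_ * _)%E.
  rewrite -integral_powR_itv0// [RHS]integral_mkcond; apply: eq_integral => y _.
  by rewrite patchE indicE; case: (y \in _); rewrite ?mul1e ?mul0e.
rewrite ge0_integralZl_EFin//; last exact/measurable_EFinP.
by rewrite integral_indic// setIT (mulrC L) [RHS]EFinM -IL.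
Qed.

Lemma area_proper (alpha : R) I : -1 < alpha -> proper_interval I ->
  exists2 a : R, 0 < a & area alpha (carleson I) = a%:E.
Proof.
move=> alpha1 pI; have [L L0 IL] := proper_interval_measure pI.
have mI : measurable I by case: pI => iI _ _; exact: is_interval_measurable.
rewrite (area_carleson alpha1 mI L0 IL); eexists; last by [].
by rewrite mulr_gt0// divr_gt0 ?powR_gt0// -ltrBlDr sub0r.
Qed.

End carleson_squares.

(** * Two shifted triadic grids *)

Section grid.
Context {R : realType}.

(* Triadic intervals of scale [3^j], shifted by [b * 3^j / 2].  Half-integers
   are stable under multiplication by 3, so each of the two grids is nested
   across scales. *)
Definition grid (b : bool) (j k : int) : set R :=
  `[3 ^ j * (k%:~R + b%:R / 2), 3 ^ j * (k%:~R + 1 + b%:R / 2)[%classic.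

Let pow3_gt0 (j : int) : 0 < (3 : R) ^ j. Proof. exact: exprz_gt0. Qed.

Lemma gridP b j k x : grid b j k x <->
  k%:~R <= x / 3 ^ j - b%:R / 2 < k%:~R + 1.
Proof.
rewrite /grid/= in_itv/= lerBrDr ltrBlDr ler_pdivlMr// ltr_pdivrMr//.
by rewrite ![_ * 3 ^ j]mulrC.
Qed.

Lemma grid_measure b j k : lebesgue_measure (grid b j k) = (3 ^ j)%:E.
Proof.
rewrite /grid lebesgue_measure_itv/= lte_fin ltr_pM2l//.
rewrite -addrA ltrD2l ltrDr ltr01 -EFinB; congr (_%:E); ring.
Qed.

Lemma grid_proper b j k : proper_interval (grid b j k).
Proof.
split; first exact: interval_is_interval.
  rewrite /grid; set u := _ * _; set v := _ * _.
  exists (`|u| + `|v|); split; first exact: num_real.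
  move=> M hM y /=; rewrite in_itv/= => /andP[uy yv]; rewrite ler_norml.
  have := ler_norm v; have := ler_norm (- u); rewrite normrN.
  have := normr_ge0 u; have := normr_ge0 v.
  by move=> *; apply/andP; split; lra.
by rewrite grid_measure lte_fin.
Qed.

(** In units of [3 ^ j], the parent [k'] starts at [3k' + 3b/2 = (3k' + b) + b/2]. Its children are
    thus [3k' + b] and the next two, whence the quotient of [k - b] by 3. *)
Lemma grid_parent b j k : exists k', grid b j k `<=` grid b (j + 1) k'.
Proof.
exists ((k - b%:Z) %/ 3)%Z => x /gridP /andP[h1 h2]; apply/gridP.
have := divz_eq (k - b%:Z) 3; have := ltz_pmod (k - b%:Z) (isT : 0 < 3 :> int).
have := modz_ge0 (k - b%:Z) (isT : 3 != 0 :> int).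
set c := (_ %/ _)%Z; set r := (_ %% _)%Z => r0 r3 kE.
have {}kE : (k%:~R = c%:~R * 3 + r%:~R + b%:R :> R).
  have -> : k = c * 3 + r + b%:Z by lia.
  by rewrite !rmorphD rmorphM /=.
have {}r0 : 0 <= r%:~R :> R by rewrite ler0z.
have {}r3 : r%:~R <= 2 :> R by rewrite (_ : 2 = 2%:~R)// ler_int; lia.
rewrite expfzDr// expr1z.
have -> : x / (3 ^ j * 3) = (x / 3 ^ j) / 3 by rewrite invfM mulrA.
move: h1 h2; rewrite kE; set y := x / 3 ^ j; set B := b%:R; clearbody y B.
by move=> h1 h2; apply/andP; split; lra.
Qed.

Lemma grid_ancestor b j j' k : (j <= j')%R ->
  exists k', grid b j k `<=` grid b j' k'.
Proof.
move=> jj'; have -> : j' = j + `|j' - j|%N by lia.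
elim: `|j' - j|%N => [|n [k' kk']]; first by exists k; rewrite addr0.
have [k2 k2E] := grid_parent b (j + n) k'.
by exists k2; rewrite (_ : j + n.+1 = j + n + 1); [exact: subset_trans k2E|lia].
Qed.

Lemma grid_inj b j k k' x : grid b j k x -> grid b j k' x -> k = k'.
Proof.
move=> /gridP/andP[h1 h2] /gridP/andP[h3 h4].
have : (k%:~R < (k' + 1)%:~R :> R) by rewrite rmorphD/=; exact: le_lt_trans h4.
have : (k'%:~R < (k + 1)%:~R :> R) by rewrite rmorphD/=; exact: le_lt_trans h2.
rewrite !ltr_int; lia.
Qed.

Lemma grid_nested b j k j' k' : (j <= j')%R ->
  grid b j k `<=` grid b j' k' \/ grid b j k `&` grid b j' k' = set0.
Proof.
move=> jj'; have [k2 h] := grid_ancestor b k jj'.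
have [->|/eqP kN] := eqVneq k' k2; [by left|right].
by apply/seteqP; split => x // -[/h h1 h2]; apply: kN; exact: grid_inj h2 h1.
Qed.

(** The scale [3 ^ j <= 6 * l < 3 ^ (j + 1)] makes [l] less than half a cell. If [a] is in the left
    half of its unshifted cell, this cell contains the interval; otherwise the cell shifted by one
    half does. *)
Lemma grid_cover (a l : R) : 0 < l -> exists b j k,
  `[a, a + l]%classic `<=` grid b j k /\ 3 ^ j <= 6 * l.
Proof.
move=> l0; have l6 : 0 < 6 * l by rewrite mulr_gt0.
have [j /andP[j1 j2]] := @exprz_bracket R 3 _ (ltr1n R 3) l6.
have {j2} lj : l / 3 ^ j < 2^-1.
  rewrite ltr_pdivrMr// -(ltr_pM2l (ltr0n R 6)).
  by apply: lt_le_trans j2 _; rewrite expfzDr// expr1z; lra.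
pose k := Num.floor (a / 3 ^ j).
have k1 : k%:~R <= a / 3 ^ j by rewrite floor_le_tmp.
have k2 : a / 3 ^ j < k%:~R + 1 by have := floorD1_gt (a / 3 ^ j); rewrite rmorphD.
exists (k%:~R + 2^-1 <= a / 3 ^ j), j, k; split=> // x /=.
rewrite in_itv/= => /andP[ax xal]; apply/gridP.
have h1 : a / 3 ^ j <= x / 3 ^ j by rewrite ler_pM2r// invr_gt0.
have h2 : x / 3 ^ j <= a / 3 ^ j + l / 3 ^ j by rewrite -mulrDl ler_pM2r// invr_gt0.
move: lj k1 k2 h1 h2; set y : R := x / _; set y0 := a / _; set e := l / _.
by case: (lerP (k%:~R + 2^-1) y0) => /= c *; apply/andP; split; lra.
Qed.

Lemma proper_interval_cover (I : set R) (x L : R) : proper_interval I ->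
  lebesgue_measure I = L%:E -> 0 < L -> I x ->
  exists b j k, I `<=` grid b j k /\ 3 ^ j <= 12 * L.
Proof.
move=> [itvI _ _] IL L0 Ix.
have L2 : 0 < 2 * L by rewrite mulr_gt0.
(* All of [I] is within distance [L] of [x], so an interval of length [2 * L] is covered; this
   doubles the constant 6 to 12. *)
have [b [j [k [h1 h2]]]] := grid_cover (x - L) L2.
exists b, j, k; split; last by apply: le_trans h2 _; lra.
have sub u v : I u -> I v -> u <= v -> v - u <= L.
  move=> Iu Iv uv; rewrite -lee_fin -IL.
  have -> : (v - u)%:E = lebesgue_measure (`[u, v]%classic : set R).
    rewrite lebesgue_measure_itv/= lte_fin; case: ltP => [_|vu]//.
    by rewrite (@le_anti _ _ u v) ?uv ?vu// subrr.
  apply: le_measure; rewrite ?inE//; first exact: is_interval_measurable.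
  by move=> w /=; rewrite in_itv/=; exact: itvI.
apply: subset_trans h1 => y Iy /=; rewrite in_itv/=.
have [xy|/ltW yx] := leP x y.
  by have := sub _ _ Ix Iy xy; move=> h; apply/andP; split; lra.
by have := sub _ _ Iy Ix yx; move=> h; apply/andP; split; lra.
Qed.

Lemma carleson_grid_nested b j k j' k' :
  [\/ carleson (grid b j k) `<=` carleson (grid b j' k'),
      carleson (grid b j' k') `<=` carleson (grid b j k) |
      carleson (grid b j k) `&` carleson (grid b j' k') = set0].
Proof.
have disj (I J : set R) : I `&` J = set0 -> carleson I `&` carleson J = set0.
  move=> IJ; apply/seteqP; split => z // -[[Iz _ _] [Jz _ _]].
  by have : (I `&` J) z.1 by []; rewrite IJ.
have mono := @carleson_mono R.
have [jj'|/ltW jj'] := leP j j'.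
  have [h|h] := grid_nested b k k' jj'.
    by apply: Or31; apply: mono => //; exact: grid_proper.
  by apply: Or33; exact: disj.
have [h|h] := grid_nested b k' k jj'.
  by apply: Or32; apply: mono => //; exact: grid_proper.
by apply: Or33; rewrite setIC; exact: disj.
Qed.

End grid.

(** * Functions on the half-plane and enclosing intervals *)

Section halfplane_functions.
Context {R : realType}.

Lemma measurable_halfplane : measurable (@halfplane R).
Proof.
have -> : @halfplane R = setT `*` `]0, +oo[%classic.
  by apply/seteqP; split => z; rewrite /halfplane/= in_itv/= andbT => // -[].
exact: measurableX.
Qed.

Lemma measurable_normc (f : R * R -> R[i]) :
  measurable_fun halfplane (fun z => complex.Re (f z)) ->
  measurable_fun halfplane (fun z => complex.Im (f z)) ->
  measurable_fun halfplane (fun z => ComplexField.Normc.normc (f z)).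
Proof.
move=> mRe mIm.
have -> : (fun z => ComplexField.Normc.normc (f z)) =
    (fun z => (complex.Re (f z) ^+ 2 + complex.Im (f z) ^+ 2) `^ 2^-1).
  apply/funext => z; rewrite powR12_sqrt ?addr_ge0 ?sqr_ge0//.
  by case: (f z).
apply: (@measurableT_comp _ _ _ _ _ _ (fun y => y `^ 2^-1)) => //.
by apply: measurable_funD; apply: measurable_funX.
Qed.

Lemma normc_ge0 (x : R[i]) : 0 <= ComplexField.Normc.normc x.
Proof. by case: x => a b; exact: sqrtr_ge0. Qed.

Lemma measurable_patch_halfplane (g : R * R -> R) :
  measurable_fun halfplane g -> measurable_fun [set: R * R] (g \_ halfplane).
Proof. by move/(measurable_restrictT _ measurable_halfplane). Qed.

(** With [I] empty this shows that the suprema at a point of the half-plane range over a nonempty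
    set. With a square of infinite mass it carries the infinite mass to a square around any given
    point. *)
Lemma interval_extend (I : set R) (z : R * R) : bounded_set I -> halfplane z ->
  exists J, [/\ proper_interval J, carleson J z & I `<=` J].
Proof.
move=> [M [_ bndI]] z0.
pose N := `|M| + 1 + `|z.1| + z.2.
have M0 := normr_ge0 M; have z10 := normr_ge0 z.1.
have JE : lebesgue_measure (`[- N, N]%classic : set R) = (N + N)%:E.
  rewrite lebesgue_measure_itv/= lte_fin ifT ?EFinN ?oppeK//.
  by move: z0; rewrite /halfplane/= /N => z0; lra.
move: z0; rewrite /halfplane/= => z0.
exists `[- N, N]%classic; split.
- split; first exact: interval_is_interval.
    exists N; split; first exact: num_real.
    by move=> x Nx y /=; rewrite in_itv/= -ler_norml => /le_trans; apply; exact: ltW.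
  by rewrite JE lte_fin /N; lra.
- split=> //; last by rewrite JE lte_fin /N; lra.
  by rewrite /= in_itv/= -ler_norml /N; lra.
- move=> x /bndI h /=; rewrite in_itv/= -ler_norml; apply: le_trans (h (`|M| + 1) _) _.
    by rewrite (le_lt_trans (ler_norm M))// ltrDl.
  by rewrite /N; lra.
Qed.

Lemma intervals_at_neq0 (z : R * R) : halfplane z -> intervals_at z !=set0.
Proof.
move=> z0; have b0 : bounded_set (set0 : set R).
  by exists 0; split; [exact: num_real|move=> x _ y].
by have [J [pJ Jz _]] := interval_extend b0 z0; exists J.
Qed.

End halfplane_functions.

(** * Comparison of Luxemburg norms on nested squares *)

Section luxemburg.
Context (R : realType) (alpha : R) (Phi : R -> R) (f : R * R -> R[i]).
Hypothesis alpha1 : -1 < alpha.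
Hypothesis yPhi : young Phi.
Hypothesis mRe : measurable_fun halfplane (fun z => complex.Re (f z)).
Hypothesis mIm : measurable_fun halfplane (fun z => complex.Im (f z)).

(** [f] is constrained on the half-plane only, while the laminar inequalities integrate over the
    whole plane. *)
Definition normc_halfplane : R * R -> R :=
  (fun z => ComplexField.Normc.normc (f z)) \_ halfplane.

Lemma normc_halfplane_ge0 z : 0 <= normc_halfplane z.
Proof.
rewrite /normc_halfplane patchE.
by case: ifP => _; [exact: normc_ge0|exact: lexx].
Qed.

Lemma normc_halfplaneE z : halfplane z ->
  normc_halfplane z = ComplexField.Normc.normc (f z).
Proof. by move=> z0; rewrite /normc_halfplane patchE mem_set. Qed.

Lemma measurable_normc_halfplane : measurable_fun [set: R * R] normc_halfplane.
Proof. by apply: measurable_patch_halfplane; exact: measurable_normc. Qed.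

Lemma orlicz_integralE I l : 0 < l ->
  integral_dV alpha (carleson I)
    (fun z => (Phi (ComplexField.Normc.normc (f z) / l))%:E) =
  (\int[lebesgue2 R]_(z in carleson I)
    (young_ext Phi (normc_halfplane z / l) * z.2 `^ alpha)%:E)%E.
Proof.
move=> l0; apply: eq_integral => z /set_mem Iz.
have z0 := carleson_halfplane Iz.
by rewrite EFinM normc_halfplaneE// young_extE// divr_ge0 ?normc_ge0// ltW.
Qed.

Lemma luxemburg_ge0 I : (0 <= luxemburg alpha Phi I f)%E.
Proof. by apply: le_ereal_inf_tmp => _ [l [l0 _] <-]; rewrite lee_fin ltW. Qed.

Lemma orlicz_maximal_ge0 z : halfplane z -> (0 <= orlicz_maximal alpha Phi f z)%E.
Proof.
move=> /intervals_at_neq0 [I Iz]; apply: le_trans (luxemburg_ge0 I) _.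
by apply: ereal_sup_ubound; exists I.
Qed.

(** By convexity, enlarging the level from [l] to [D * l] divides [Phi] by at least [D], which pays
    for the ratio of the areas. *)
Lemma le_luxemburg_subset I J D l : proper_interval I -> proper_interval J ->
  I `<=` J -> 1 <= D -> (area alpha (carleson J) <= D%:E * area alpha (carleson I))%E ->
  0 < l ->
  ((area alpha (carleson J))^-1 * integral_dV alpha (carleson J)
     (fun z => (Phi (ComplexField.Normc.normc (f z) / l))%:E) <= 1)%E ->
  (luxemburg alpha Phi I f <= (D * l)%:E)%E.
Proof.
move=> pI pJ IJ D1 aIJ l0 hJ.
have D0 : 0 < D by exact: lt_le_trans D1.
have [a a0 aE] := area_proper alpha1 pI.
have [b b0 bE] := area_proper alpha1 pJ.
apply: ereal_inf_lbound; exists (D * l) => //; split; first exact: mulr_gt0.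
move: hJ aIJ; rewrite aE bE !inver !gt_eqF//.
rewrite !lee_pdivrMl// !mule1 !orlicz_integralE ?mulr_gt0// => hJ aIJ.
have mg l' (K : set (R * R)) : measurable_fun K (fun z =>
    (young_ext Phi (normc_halfplane z / l') * z.2 `^ alpha)%:E).
  apply/measurable_EFinP/measurable_funTS/measurable_funM; last first.
    exact: measurable_snd_powR.
  apply: (@measurableT_comp _ _ _ _ _ _ (young_ext Phi)).
    exact: nondecreasing_measurable (young_ext_nd yPhi).
  by apply: measurable_funM => //; exact: measurable_normc_halfplane.
have g0 l' z : (0 <= (young_ext Phi (normc_halfplane z / l') * z.2 `^ alpha)%:E)%E.
  by rewrite lee_fin mulr_ge0 ?powR_ge0// young_ext_ge0.
apply: (@le_trans _ _ (D^-1%:E * b%:E)%E); last first.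
  by rewrite lee_pdivrMl.
apply: (@le_trans _ _ (D^-1%:E * \int[lebesgue2 R]_(z in carleson J)
    (young_ext Phi (normc_halfplane z / l) * z.2 `^ alpha)%:E)%E); last first.
  by apply: lee_wpmul2l => //; rewrite lee_fin invr_ge0 ltW.
have mI := measurable_carleson pI; have mJ := measurable_carleson pJ.
rewrite -ge0_integralZl_EFin//; [|exact: mg|by rewrite invr_ge0 ltW].
apply: (@le_trans _ _ (\int[lebesgue2 R]_(z in carleson I)
    (D^-1%:E * (young_ext Phi (normc_halfplane z / l) * z.2 `^ alpha)%:E))%E).
  apply: ge0_le_integral_lower => z _ //.
  rewrite -EFinM lee_fin mulrA ler_wpM2r ?powR_ge0//.
  rewrite invfM mulrCA; apply: young_ext_scale => //.
    by rewrite invr_ge0 (ltW D0)/= invf_le1.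
  by rewrite divr_ge0 ?normc_halfplane_ge0// ltW.
apply: ge0_subset_integral => //.
- by apply: measurable_funeM; exact: mg.
- by move=> z _; rewrite mule_ge0// lee_fin invr_ge0 ltW.
- exact: carleson_mono.
Qed.

End luxemburg.

(** * Masses of Carleson squares, and the degenerate case *)

Section weight.
Context (R : realType) (alpha : R) (omega : R * R -> R).
Hypotheses (alpha1 : -1 < alpha) (womega : weight omega).

Definition weight_density (z : R * R) : R :=
  (omega \_ halfplane) z * z.2 `^ alpha.

Lemma weight_density_ge0 z : 0 <= weight_density z.
Proof.
rewrite mulr_ge0 ?powR_ge0// patchE; case: ifP => [/set_mem z0|_]; last exact: lexx.
by case: womega => + _ _; apply.
Qed.

Lemma measurable_weight_density : measurable_fun [set: R * R] weight_density.
Proof.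
apply: measurable_funM; last exact: measurable_snd_powR.
by apply: measurable_patch_halfplane; case: womega.
Qed.

Lemma wareaE I : warea alpha omega (carleson I) =
  (\int[lebesgue2 R]_(z in carleson I) (weight_density z)%:E)%E.
Proof.
apply: eq_integral => z /set_mem /carleson_halfplane z0.
by rewrite /weight_density patchE mem_set// EFinM.
Qed.

Lemma areaE I : area alpha (carleson I) =
  (\int[lebesgue2 R]_(z in carleson I) (z.2 `^ alpha)%:E)%E.
Proof. by apply: eq_integral => z _; rewrite mul1e. Qed.

Lemma warea_ge0 I : (0 <= warea alpha omega (carleson I))%E.
Proof.
rewrite wareaE; apply: integral_ge0 => z _.
by rewrite lee_fin weight_density_ge0.
Qed.

Lemma le_maximal I z : proper_interval I -> carleson I z ->
  ((area alpha (carleson I))^-1 * warea alpha omega (carleson I) <=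
   maximal alpha omega z)%E.
Proof.
move=> pI Iz; apply: ereal_sup_ubound; exists I => //.
by rewrite indicE mem_set// mul1e.
Qed.

Lemma maximal_ge0 z : halfplane z -> (0 <= maximal alpha omega z)%E.
Proof.
move=> /intervals_at_neq0 [I [pI Iz]]; apply: le_trans (le_maximal pI Iz).
by rewrite mule_ge0 ?warea_ge0// inve_ge0; have [a a0 ->] := area_proper alpha1 pI;
  rewrite lee_fin ltW.
Qed.

Lemma maximal_pinfty I z : proper_interval I ->
  warea alpha omega (carleson I) = +oo%E -> halfplane z ->
  maximal alpha omega z = +oo%E.
Proof.
move=> pI Ioo z0.
have [J [pJ Jz IJ]] := interval_extend (let: And3 _ bI _ := pI in bI) z0.
have Joo : warea alpha omega (carleson J) = +oo%E.
  apply/eqP; rewrite -leye_eq -Ioo !wareaE; apply: ge0_subset_integral.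
  - exact: measurable_carleson.
  - exact: measurable_carleson.
  - by apply/measurable_EFinP/measurable_funTS; exact: measurable_weight_density.
  - by move=> x _; rewrite lee_fin weight_density_ge0.
  - exact: carleson_mono.
apply/eqP; rewrite -leye_eq; apply: le_trans (le_maximal pJ Jz).
have [a a0 ->] := area_proper alpha1 pJ.
by rewrite Joo inver gt_eqF// gt0_muley// lte_fin invr_gt0.
Qed.

Variable mu : {measure set (R * R) -> \bar R}.

Lemma le_Kmu I z : proper_interval I -> carleson I z ->
  (mu (carleson I) / warea alpha omega (carleson I) <= Kmu alpha omega mu z)%E.
Proof. by move=> pI Iz; apply: ereal_sup_ubound; exists I. Qed.

Lemma Kmu_ge0 z : halfplane z -> (0 <= Kmu alpha omega mu z)%E.
Proof.
move=> /intervals_at_neq0 [I [pI Iz]]; apply: le_trans (le_Kmu pI Iz).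
by rewrite mule_ge0// inve_ge0 warea_ge0.
Qed.

(* A square on which the ratio is infinite would make [Kmu] infinite on a set
   of positive Lebesgue measure. *)
Lemma Kmu_ratio_fin I : proper_interval I ->
  {ae lebesgue2 R, forall z, halfplane z -> Kmu alpha omega mu z \is a fin_num} ->
  (mu (carleson I) / warea alpha omega (carleson I) < +oo)%E.
Proof.
move=> pI [N [mN N0 KN]]; rewrite ltey; apply/eqP => Ioo.
have mI := measurable_carleson pI.
have IN : carleson I `<=` N.
  move=> z Iz; apply: KN => /= /(_ (carleson_halfplane Iz)).
  have -> : Kmu alpha omega mu z = +oo%E.
    by apply/eqP; rewrite -leye_eq -Ioo; exact: le_Kmu.
  by [].
have [a a0] := area_proper alpha1 pI; rewrite areaE.
rewrite (@ge0_negligible_integral _ _ _ (lebesgue2 R) _ N)//.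
- rewrite (_ : _ `\` N = set0) ?integral_set0; last by rewrite setD_eq0.
  by move=> -[a00]; rewrite -a00 ltxx in a0.
- by apply/measurable_EFinP/measurable_funTS; exact: measurable_snd_powR.
- by move=> z _; rewrite lee_fin powR_ge0.
Qed.

Hypothesis warea_fin : forall I, proper_interval I ->
  (warea alpha omega (carleson I) < +oo)%E.
Hypothesis Kmu_fin : {ae lebesgue2 R, forall z, halfplane z ->
  Kmu alpha omega mu z \is a fin_num}.

(** The inverse of 0 is [+oo], so positive [mu]-mass over zero weighted area would be an infinite
    ratio, which [Kmu_ratio_fin] excludes. *)
Lemma carleson_measure_ac I : proper_interval I ->
  warea alpha omega (carleson I) = 0%E -> mu (carleson I) = 0%E.
Proof.
move=> pI w0; have := Kmu_ratio_fin pI Kmu_fin; rewrite w0 inve0.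
have [->//|muN0] := eqVneq (mu (carleson I)) 0%E.
by rewrite gt0_muley ?ltxx// lt0e muN0 measure_ge0.
Qed.

Lemma carleson_measure_fin I : proper_interval I -> (mu (carleson I) < +oo)%E.
Proof.
move=> pI; have [/(carleson_measure_ac pI) ->|wN0] :=
  eqVneq (warea alpha omega (carleson I)) 0%E; first exact: ltry.
have := Kmu_ratio_fin pI Kmu_fin; have := warea_fin pI.
move: (warea_ge0 I) wN0; case: (warea alpha omega (carleson I)) => [w| |]//.
rewrite lee_fin eqe inver => w0 /negbTE wN0 _; rewrite wN0.
case: (mu (carleson I)) => [m| |]//; rewrite ?ltry//.
by rewrite gt0_mulye// lte_fin invr_gt0 lt0r wN0.
Qed.

End weight.

(** [maximal] is infinite on the whole half-plane, so a finite integral forces [f] to vanish almost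
    everywhere. Every positive level is then admissible on every square, and all the norms are
    zero. *)
Lemma orlicz_maximal_degenerate (R : realType) (alpha p : R)
    (omega : R * R -> R) (Phi : R -> R) (I : set R) (f : R * R -> R[i]) :
  -1 < alpha -> 0 < p -> weight omega -> young Phi -> proper_interval I ->
  warea alpha omega (carleson I) = +oo%E ->
  measurable_fun halfplane (fun z => complex.Re (f z)) ->
  measurable_fun halfplane (fun z => complex.Im (f z)) ->
  (integral_dV alpha halfplane
     (fun z => (ComplexField.Normc.normc (f z) `^ p)%:E * maximal alpha omega z)
   < +oo)%E ->
  forall z, halfplane z -> orlicz_maximal alpha Phi f z = 0%E.
Proof.
move=> alpha1 p0 womega yPhi pI Ioo mRe mIm Xfin.
pose F := normc_halfplane f.
have mF : measurable_fun [set: R * R] F by exact: measurable_normc_halfplane.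
have F0 z : 0 <= F z by exact: normc_halfplane_ge0.
(* As 0 times [+oo] is 0, [h] is finite exactly where [F] vanishes, on the half-plane; integrability
   makes it finite almost everywhere. *)
pose h (z : R * R) : \bar R := ((F z `^ p)%:E * (+oo * (z.2 `^ alpha)%:E))%E.
have h0 z : (0 <= h z)%E by rewrite !mule_ge0// lee_fin powR_ge0.
have mh : measurable_fun (@halfplane R) h.
  apply: measurable_funTS; apply: emeasurable_funM.
    apply/measurable_EFinP.
    by apply: (@measurableT_comp _ _ _ _ _ _ (fun y => y `^ p)).
  apply: emeasurable_funM => //; apply/measurable_EFinP.
  exact: measurable_snd_powR.
have hI : (lebesgue2 R).-integrable halfplane h.
  apply/integrableP; split=> //.
  under eq_integral do rewrite gee0_abs//.
  apply: le_lt_trans Xfin; rewrite le_eqVlt; apply/orP; left; apply/eqP.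
  apply: eq_integral => z /set_mem z0; rewrite /h /F normc_halfplaneE// muleA.
  by rewrite (maximal_pinfty alpha1 womega pI Ioo z0).
have := @integrable_ae _ _ R (lebesgue2 R) halfplane measurable_halfplane h hI.
move=> [N [mN N0 hN]].
have F_eq0 z : halfplane z -> ~ N z -> F z = 0.
  move=> z0 zN; apply/eqP; apply: contra_notT zN => Fz.
  apply: hN => /= /(_ z0).
  have z2 : (0 < (z.2 `^ alpha)%:E)%E by rewrite lte_fin; apply: powR_gt0; exact: z0.
  have Fp : (0 < (F z `^ p)%:E)%E by rewrite lte_fin powR_gt0// lt0r Fz F0.
  by rewrite /h gt0_mulye// gt0_muley.
move=> z z0; apply/eqP; rewrite eq_le orlicz_maximal_ge0// andbT.
apply: ge_ereal_sup => _ [J [pJ Jz] <-].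
apply/lee_addgt0Pr => e e0; rewrite add0e.
apply: ereal_inf_lbound; exists e => //; split=> //.
rewrite orlicz_integralE// (@ge0_negligible_integral _ _ _ (lebesgue2 R) _ N)//.
- rewrite integral0_eq ?mule0// => x [Jx Nx].
  have -> : normc_halfplane f x = 0 by apply: F_eq0 Nx; exact: carleson_halfplane Jx.
  by rewrite mul0r young_extE// (_ : Phi 0 = 0) ?mul0r//; case: yPhi => -[].
- exact: measurable_carleson.
- apply/measurable_EFinP/measurable_funTS/measurable_funM; last first.
    exact: measurable_snd_powR.
  apply: (@measurableT_comp _ _ _ _ _ _ (young_ext Phi)).
    exact: nondecreasing_measurable (young_ext_nd yPhi).
  exact: measurable_funM.
- by move=> x _; rewrite lee_fin mulr_ge0 ?powR_ge0// young_ext_ge0.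
Qed.

(** * Domination of the Orlicz maximal function by the two grids *)

Section dyadic_model.
Context (R : realType) (alpha : R) (Phi : R -> R) (f : R * R -> R[i]).
Hypothesis alpha1 : -1 < alpha.
Hypothesis yPhi : young Phi.
Hypothesis mRe : measurable_fun halfplane (fun z => complex.Re (f z)).
Hypothesis mIm : measurable_fun halfplane (fun z => complex.Im (f z)).

(* An index [(j, k, l)] stands for the square of the interval [(j, k)] of a
   grid together with the level [2^l] of the maximal function. *)
Definition grid_index (n : nat) : int * int * int :=
  odflt (0, 0, 0) (unpickle n).

Definition grid_square (b : bool) (n : nat) : set (R * R) :=
  carleson (grid b (grid_index n).1.1 (grid_index n).1.2).

Definition grid_level (n : nat) : R := 2 ^ (grid_index n).2.

(** A level counts only if it fails the test in the definition of [luxemburg] on its square. *)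
Definition grid_coef (b : bool) (n : nat) : R :=
  if `[< ((area alpha (grid_square b n))^-1 *
          integral_dV alpha (grid_square b n)
            (fun z => (Phi (ComplexField.Normc.normc (f z) / grid_level n))%:E)
          <= 1)%E >]
  then 0 else grid_level n.

Lemma grid_level_gt0 n : 0 < grid_level n. Proof. exact: exprz_gt0. Qed.

Lemma grid_coef_ge0 b n : 0 <= grid_coef b n.
Proof. by rewrite /grid_coef; case: ifP => // _; rewrite ltW ?grid_level_gt0. Qed.

Lemma grid_coefE b n : 0 < grid_coef b n -> grid_coef b n = grid_level n.
Proof. by rewrite /grid_coef; case: ifP => //; rewrite ltxx. Qed.

Lemma grid_coef_avg b n : 0 < grid_coef b n ->
  (\int[lebesgue2 R]_(z in grid_square b n) (z.2 `^ alpha)%:E <=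
   \int[lebesgue2 R]_(z in grid_square b n)
     (young_ext Phi (normc_halfplane f z / grid_coef b n) * z.2 `^ alpha)%:E)%E.
Proof.
move=> c0; rewrite (grid_coefE c0); move: c0; rewrite /grid_coef.
case: asboolP => [_|/negP avg _]; first by rewrite ltxx.
rewrite -areaE -orlicz_integralE ?grid_level_gt0//.
have [a a0 aE] := area_proper alpha1
  (grid_proper b (grid_index n).1.1 (grid_index n).1.2).
move: avg; rewrite -/(grid_square b n) in aE *; rewrite aE inver gt_eqF//.
by rewrite lee_pdivrMl// mule1 -ltNge => /ltW.
Qed.

Definition grid_maximal (b : bool) : R * R -> \bar R :=
  indic_sup (grid_square b) (grid_coef b).

Lemma grid_maximal_ge0 b z : (0 <= grid_maximal b z)%E.
Proof. by apply: indic_sup_ge0 => n; exact: grid_coef_ge0. Qed.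

Lemma measurable_grid_square b n : measurable (grid_square b n).
Proof. by apply: measurable_carleson; exact: grid_proper. Qed.

Lemma laminar_grid_square b : laminar (grid_square b).
Proof. by move=> i j; exact: carleson_grid_nested. Qed.

(** Areas scale like the length to the power [alpha + 2], and a covering grid interval is at most 12
    times longer. *)
Definition doubling : R := 12 * 12 `^ (alpha + 1).

Lemma doubling_ge1 : 1 <= doubling.
Proof.
have h : 1 <= (12 : R) `^ (alpha + 1).
  by rewrite -{1}(powRr0 12) ler_powR ?ler1n// -lerBlDr sub0r ltW.
by apply: le_trans h _; rewrite /doubling ler_peMl ?powR_ge0// ler1n.
Qed.

Lemma area_doubling I J (K L : R) : proper_interval I -> proper_interval J ->
  lebesgue_measure I = L%:E -> lebesgue_measure J = K%:E ->
  0 < L -> 0 < K -> K <= 12 * L ->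
  (area alpha (carleson J) <= doubling%:E * area alpha (carleson I))%E.
Proof.
move=> [iI _ _] [iJ _ _] IL JK L0 K0 KL.
have a1 : 0 < alpha + 1 by rewrite -ltrBlDr sub0r.
rewrite (area_carleson alpha1 (is_interval_measurable iI) L0 IL).
rewrite (area_carleson alpha1 (is_interval_measurable iJ) K0 JK) -EFinM lee_fin.
apply: le_trans (_ : 12 * L * ((12 * L) `^ (alpha + 1) / (alpha + 1)) <= _).
  apply: ler_pM => //; [exact: ltW|by rewrite divr_ge0 ?powR_ge0// ltW|].
  rewrite ler_wpM2r ?invr_ge0 ?(ltW a1)// ge0_ler_powR ?nnegrE ?(ltW a1) ?(ltW K0)//.
  by rewrite mulr_ge0// ltW.
rewrite powRM ?(ltW L0)// /doubling le_eqVlt; apply/orP; left; apply/eqP; ring.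
Qed.

(** The level [2 ^ (l + 1)] exceeds [x], hence both grid maxima at [z], so it must be admissible on
    the grid square covering that of [I]. Passing to the smaller square costs [doubling], and
    [2 ^ (l + 1) <= 2 * x] costs 2. *)
Lemma orlicz_maximal_le_level z (x : R) : halfplane z -> 0 < x ->
  (maxe (grid_maximal false z) (grid_maximal true z) <= x%:E)%E ->
  (orlicz_maximal alpha Phi f z <= (2 * doubling * x)%:E)%E.
Proof.
move=> z0 x0 Nx; have [l /andP[l1 l2]] := @exprz_bracket R 2 x (ltr1n R 2) x0.
apply: ge_ereal_sup => _ [I [pI [Iz zy zI]] <-].
have [L L0 IL] := proper_interval_measure pI.
have [b [j [k [Isub jL]]]] := proper_interval_cover pI IL L0 Iz.
have pJ : proper_interval (grid b j k : set R) by exact: grid_proper.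
pose n := pickle (j, k, l + 1).
have nE : grid_index n = (j, k, l + 1) by rewrite /grid_index pickleK.
have lE : grid_level n = 2 ^ (l + 1) by rewrite /grid_level nE.
have An : grid_square b n z.
  by rewrite /grid_square nE; apply: (carleson_mono pI pJ Isub); split.
have Nb : (grid_maximal b z <= x%:E)%E.
  by apply: le_trans Nx; rewrite le_max; case: (b); rewrite lexx ?orbT.
have cx : grid_coef b n <= x.
  by rewrite -lee_fin; apply: le_trans Nb; exact: indic_sup_ge.
have avg : ((area alpha (carleson (grid b j k)))^-1 *
    integral_dV alpha (carleson (grid b j k))
      (fun z => (Phi (ComplexField.Normc.normc (f z) / 2 ^ (l + 1)))%:E) <= 1)%E.
  move: cx; rewrite /grid_coef; case: asboolP.
    by rewrite /grid_square lE nE.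
  by move=> _; rewrite lE leNgt l2.
have l0 : 0 < (2 : R) ^ (l + 1) by exact: exprz_gt0.
have aJ : (area alpha (carleson (grid b j k)) <= doubling%:E * area alpha (carleson I))%E.
  by apply: (area_doubling pI pJ IL (grid_measure b j k)) => //; exact: exprz_gt0.
apply: le_trans (le_luxemburg_subset alpha1 yPhi mRe mIm pI pJ Isub doubling_ge1
  aJ l0 avg) _.
rewrite lee_fin expfzDr ?pnatr_eq0// expr1z.
have := ler_wpM2l (le_trans ler01 doubling_ge1) l1; lra.
Qed.

Lemma orlicz_maximal_le_grid z : halfplane z ->
  (orlicz_maximal alpha Phi f z <=
   (2 * doubling)%:E * maxe (grid_maximal false z) (grid_maximal true z))%E.
Proof.
move=> z0; have D0 : 0 < 2 * doubling.
  by rewrite mulr_gt0// (lt_le_trans ltr01 doubling_ge1).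
have N0 : (0 <= maxe (grid_maximal false z) (grid_maximal true z))%E.
  by rewrite le_max grid_maximal_ge0.
have := @orlicz_maximal_le_level z ^~ z0.
move: N0; case: (maxe _ _) => [n| |]//; last by rewrite gt0_muley ?leey.
(* The grid maximum may be 0, which no power of 2 brackets; hence the margin [e]. *)
rewrite lee_fin => n0 h; apply/lee_addgt0Pr => e e0.
have e0' : 0 < e / (2 * doubling) by rewrite divr_gt0.
apply: le_trans (h (n + e / (2 * doubling)) _ _) _.
- by rewrite ltr_wpDl.
- by rewrite lee_fin lerDl ltW.
by rewrite -EFinM -EFinD lee_fin mulrDr [X in _ + X]mulrC divfK// gt_eqF.
Qed.

Lemma orlicz_maximal_poweR_le q z : 0 < q -> halfplane z ->
  (orlicz_maximal alpha Phi f z `^ q <= ((2 * doubling) `^ q)%:E *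
    (grid_maximal false z `^ q + grid_maximal true z `^ q))%E.
Proof.
move=> q0 z0; have D0 : 0 <= 2 * doubling.
  by rewrite mulr_ge0// (le_trans ler01 doubling_ge1).
apply: le_trans (ge0_le_poweR (ltW q0) (orlicz_maximal_ge0 _ _ _ z0)
  (orlicz_maximal_le_grid z0)) _.
have N0 : (0 <= maxe (grid_maximal false z) (grid_maximal true z))%E.
  by rewrite le_max grid_maximal_ge0.
rewrite poweRM ?lee_fin// poweR_EFin; apply: lee_wpmul2l.
  by rewrite lee_fin powR_ge0.
by case: (leP (grid_maximal false z)) => _; [apply: leeDr|apply: leeDl]; exact: poweR_ge0.
Qed.

End dyadic_model.

(* The carriers [R] and [measurableTypeR R] have the same measurable sets but
   different displays; [lebesgue2] lives on the second plane, so [mu] is moved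
   there. *)
Section plane_measure.
Local Open Scope ereal_scope.
Context (R : realType) (mu : {measure set (R * R) -> \bar R}).

Definition plane_measure (E : set (measurableTypeR R * measurableTypeR R)) : \bar R :=
  mu E.

Let plane_measure0 : plane_measure set0 = 0. Proof. exact: measure0. Qed.

Let plane_measure_ge0 E : 0 <= plane_measure E. Proof. exact: measure_ge0. Qed.

Let plane_measure_sigma_additive : semi_sigma_additive plane_measure.
Proof. exact: (@measure_semi_sigma_additive _ _ _ mu). Qed.

HB.instance Definition _ := isMeasure.Build _ _ _ plane_measure
  plane_measure0 plane_measure_ge0 plane_measure_sigma_additive.

Let measurable_id_plane : measurable_fun [set: R * R]
  (fun z => z : measurableTypeR R * measurableTypeR R).
Proof. by move=> _ Y mY; rewrite setTI. Qed.

Lemma integral_plane_measure (g : R * R -> \bar R) :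
  measurable_fun [set: R * R] g -> (forall z, 0 <= g z) ->
  \int[mu]_z g z = \int[plane_measure]_z g z.
Proof.
move=> mg g0; apply/esym.
by apply: (ge0_integral_pushforward measurable_id_plane mu measurableT mg).
Qed.

End plane_measure.

(** * The laminar inequality transferred to the half-plane *)

Section grid_bound.
Context (R : realType) (alpha p q : R) (omega : R * R -> R)
  (mu : {measure set (R * R) -> \bar R}) (Phi : R -> R) (f : R * R -> R[i]).
Hypotheses (alpha1 : -1 < alpha) (q0 : 0 < q) (qp : q < p).
Hypotheses (womega : weight omega) (yPhi : young Phi).
Hypothesis warea_fin : forall I, proper_interval I ->
  (warea alpha omega (carleson I) < +oo)%E.
Hypothesis Kmu_fin : {ae lebesgue2 R, forall z, halfplane z ->
  Kmu alpha omega mu z \is a fin_num}.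
Hypothesis mRe : measurable_fun halfplane (fun z => complex.Re (f z)).
Hypothesis mIm : measurable_fun halfplane (fun z => complex.Im (f z)).
Variables (S B : R).
Hypothesis PhiS : forall n,
  \sum_(j < n) (2 ^+ j) `^ (- p) * young_ext Phi (2 ^+ j) <= S.
Hypothesis B0 : 0 < B.
Hypothesis KB : (integral_dV alpha halfplane
  (fun z => `|Kmu alpha omega mu z| `^ (p / (p - q)) * maximal alpha omega z)
  <= B%:E)%E.

Let T := (measurableTypeR R * measurableTypeR R)%type.
Let m : {measure set T -> \bar R} := lebesgue2 R.
Let nu := plane_measure mu.
Let A (b : bool) : nat -> set T := @grid_square R b.
Let u : T -> R := weight_density alpha omega.
Let rho (z : T) : R := z.2 `^ alpha.
Let W b : T -> \bar R := indic_sup (A b) (weight_ratio m (A b) u rho).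
Let K b : T -> \bar R := indic_sup (A b) (measure_ratio m nu (A b) u).

Let W_ge0 b z : (0 <= W b z)%E.
Proof.
apply: indic_sup_ge0 => i; apply: divr_ge0; apply: fine_ge0.
  by rewrite -wareaE; exact: warea_ge0.
by apply: integral_ge0 => x _; rewrite lee_fin powR_ge0.
Qed.

Let K_ge0 b z : (0 <= K b z)%E.
Proof.
apply: indic_sup_ge0 => i; apply: divr_ge0; apply: fine_ge0 => //.
by rewrite -wareaE; exact: warea_ge0.
Qed.

Let W_le_maximal b z : halfplane z -> (W b z <= maximal alpha omega z)%E.
Proof.
move=> z0; apply: indic_sup_le => [|i Ai]; first exact: maximal_ge0.
pose I : set R := grid b (grid_index i).1.1 (grid_index i).1.2.
have pI : proper_interval I by exact: grid_proper.
apply: le_trans (le_maximal alpha omega pI Ai).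
have [a a0 aE] := area_proper alpha1 pI.
have wf : warea alpha omega (carleson I) \is a fin_num.
  by rewrite ge0_fin_numE ?warea_ge0// warea_fin.
rewrite /weight_ratio -wareaE -areaE aE inver gt_eqF//=.
by rewrite -(fineK wf) -EFinM lee_fin mulrC.
Qed.

Let K_le_Kmu b z : halfplane z -> (K b z <= Kmu alpha omega mu z)%E.
Proof.
move=> z0; apply: indic_sup_le => [|i Ai]; first exact: Kmu_ge0.
pose I : set R := grid b (grid_index i).1.1 (grid_index i).1.2.
have pI : proper_interval I by exact: grid_proper.
rewrite /measure_ratio -wareaE -/I.
have wf : warea alpha omega (carleson I) \is a fin_num.
  by rewrite ge0_fin_numE ?warea_ge0// warea_fin.
(* Real and extended division differ at 0, so this case is treated apart: the real ratio is 0. *)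
have [w0|wN0] := eqVneq (fine (warea alpha omega (carleson I))) 0.
  by rewrite w0 invr0 mulr0; exact: Kmu_ge0.
apply: le_trans (le_Kmu alpha omega mu pI Ai).
have mf : mu (carleson I) \is a fin_num.
  rewrite ge0_fin_numE//.
  exact: (carleson_measure_fin alpha1 womega warea_fin Kmu_fin pI).
rewrite -[X in (_ <= X / _)%E](fineK mf) -[X in (_ <= _ / X)%E](fineK wf).
by rewrite inver (negbTE wN0) -EFinM.
Qed.

Let indic_sup_off (c : nat -> R) b (z : T) : (forall i, 0 <= c i) -> ~ halfplane z ->
  indic_sup (A b) c z = 0%E.
Proof.
move=> c0 zN; apply/eqP; rewrite eq_le indic_sup_ge0// andbT.
by apply: indic_sup_le => // i /carleson_halfplane.
Qed.

(** The laminar inequality involves [W] and [K]; monotonicity of the integral then replaces them by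
    [maximal] and [Kmu]. Off the half-plane the integrands on the grid side vanish, since the
    squares lie inside it and [f] is extended by 0. *)
Lemma grid_maximal_integral b :
  (\int[plane_measure mu]_z (grid_maximal alpha Phi f b z `^ q) <=
   ((4 * 2 `^ p * S)%:E * integral_dV alpha halfplane
      (fun z => (ComplexField.Normc.normc (f z) `^ p)%:E * maximal alpha omega z))
     `^ (q / p) * (B `^ (p / (p - q))^-1)%:E)%E.
Proof.
have p0 : 0 < p by exact: lt_trans qp.
have S0 : 0 <= S by apply: le_trans (PhiS 0); rewrite big_ord0.
have pA i : proper_interval (grid b (grid_index i).1.1 (grid_index i).1.2 : set R).
  exact: grid_proper.
have aE i : exists2 a : R, 0 < a &
    (\int[m]_(z in A b i) (rho z)%:E)%E = a%:E.
  by rewrite -areaE; exact: area_proper.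
have aU i : (\int[m]_(z in A b i) (u z)%:E)%E = warea alpha omega (A b i).
  by rewrite wareaE.
have s0 : 0 < p / (p - q) by rewrite divr_gt0 ?subr_gt0.
have KWB : (\int[m]_z (K b z `^ (p / (p - q)) * (W b z * (rho z)%:E)) <= B%:E)%E.
  apply: le_trans KB; rewrite /integral_dV [leRHS]integral_mkcond.
  apply: ge0_le_integral_lower => z _.
    by rewrite !mule_ge0 ?poweR_ge0// lee_fin powR_ge0.
  rewrite patchE; case: ifPn => [/set_mem z0|/negP zN]; last first.
    rewrite /K indic_sup_off ?poweR0r ?mul0e ?gt_eqF//.
      move=> i; apply: divr_ge0; apply: fine_ge0 => //.
      by rewrite aU; exact: warea_ge0.
    by move=> z0; apply: zN; rewrite inE.
  rewrite -muleA; apply: lee_pmul.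
  - exact: poweR_ge0.
  - by rewrite mule_ge0// lee_fin powR_ge0.
  - apply: ge0_le_poweR => //; first exact: ltW.
    by rewrite gee0_abs ?Kmu_ge0// K_le_Kmu.
  - by apply: lee_wpmul2r; [rewrite lee_fin powR_ge0|exact: W_le_maximal].
have h := @laminar_maximal_integral _ T R m nu (A b)
  (@laminar_grid_square R b) (@measurable_grid_square R b) u rho
  (measurable_weight_density alpha womega) (measurable_snd_powR alpha)
  (weight_density_ge0 alpha womega) (fun z => powR_ge0 _ _) _ _ _ _ _
  p q S (young_ext Phi) q0 qp (young_ext_ge0 yPhi) (young_ext_nd yPhi)
  (young_ext_half yPhi) PhiS B B0 KWB (normc_halfplane f)
  (measurable_normc_halfplane mRe mIm) (normc_halfplane_ge0 f)
  (grid_coef alpha Phi f b) (fun i => (grid_index i).2)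
  (grid_coef_ge0 alpha Phi f b) _ _.
apply: le_trans (h _ _ _ _ _ _ _) _.
- by move=> i; have [a a0 ->] := aE i; rewrite lte_fin.
- by move=> i; have [a a0 ->] := aE i; exact: ltry.
- by move=> i; rewrite aU; exact: warea_fin.
- by move=> i; exact: (carleson_measure_fin alpha1 womega warea_fin Kmu_fin).
- move=> i; rewrite aU => w0.
  exact: (carleson_measure_ac alpha1 Kmu_fin (pA i) w0).
- by move=> i; exact: grid_coefE.
- by move=> i; exact: grid_coef_avg.
apply: lee_wpmul2r; first by rewrite lee_fin powR_ge0.
apply: ge0_le_poweR; first by rewrite ltW// divr_gt0.
  rewrite mule_ge0 ?lee_fin ?mulr_ge0 ?powR_ge0//; apply: integral_ge0 => z _.
  by rewrite !mule_ge0 ?lee_fin ?powR_ge0//; exact: W_ge0.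
apply: lee_wpmul2l; first by rewrite lee_fin !mulr_ge0// powR_ge0.
rewrite /integral_dV [leRHS]integral_mkcond.
apply: ge0_le_integral_lower => z _.
  by rewrite !mule_ge0 ?lee_fin ?powR_ge0//; exact: W_ge0.
rewrite patchE; case: ifPn => [/set_mem z0|zN]; last first.
  by rewrite /normc_halfplane patchE (negbTE zN) powR0 ?mul0e// gt_eqF.
rewrite normc_halfplaneE// muleA; apply: lee_wpmul2r; first by rewrite lee_fin powR_ge0.
by apply: lee_wpmul2l; [rewrite lee_fin powR_ge0|exact: W_le_maximal].
Qed.

End grid_bound.

Theorem theorem1p6 (R : realType) (alpha p q : R)
    (omega : R * R -> R) (mu : {measure set (R * R) -> \bar R})
    (Phi : R -> R)
    (halpha : -1 < alpha) (hq : 1 < q) (hqp : q < p)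
    (homega : weight omega)
    (hPhi : Bclass p Phi)
    (hK : memL alpha (p / (p - q)) (maximal alpha omega)
            (Kmu alpha omega mu)) :
  exists2 C : R, 0 < C &
    forall f : R * R -> R[i],
      measurable_fun halfplane (fun z => complex.Re (f z)) ->
      measurable_fun halfplane (fun z => complex.Im (f z)) ->
      ((\int[mu]_(z in halfplane)
          (orlicz_maximal alpha Phi f z `^ q)) `^ q^-1 <=
       C%:E *
       (integral_dV alpha halfplane
          (fun z => (ComplexField.Normc.normc (f z) `^ p)%:E *
                    maximal alpha omega z)) `^ p^-1)%E.
Proof.
have q0 : 0 < q by exact: lt_trans hq.
have p0 : 0 < p by exact: lt_trans hqp.
have yPhi : young Phi by case: hPhi.
have X0 (f : R * R -> R[i]) : (0 <= integral_dV alpha halfplane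
    (fun z => (ComplexField.Normc.normc (f z) `^ p)%:E * maximal alpha omega z))%E.
  apply: integral_ge0 => z z0.
  by rewrite !mule_ge0 ?lee_fin ?powR_ge0//; exact: maximal_ge0.
(* When some square has infinite mass, the constant 1 works: the right side is infinite or the left
   side is zero. *)
have [[I pI Ioo]|nI] := pselect (exists2 I, proper_interval I &
    warea alpha omega (carleson I) = +oo%E).
  exists 1 => // f mRe mIm; rewrite mul1e.
  have := X0 f; set X := integral_dV _ _ _ => {}X0.
  have [->|Xfin] := eqVneq X +oo%E.
    by rewrite poweRyr ?leey// invr_eq0 gt_eqF.
  rewrite integral0_eq; first by rewrite poweR0r ?poweR_ge0// invr_eq0 gt_eqF.
  move=> z z0; rewrite (orlicz_maximal_degenerate halpha p0 homega yPhi pI) //.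
    by rewrite poweR0r// gt_eqF.
  by rewrite ltey.
have wfin I : proper_interval I -> (warea alpha omega (carleson I) < +oo)%E.
  by move=> pI; rewrite ltey; apply/eqP => Ioo; apply: nI; exists I.
have [S PhiS] := Bclass_scale_sum yPhi p0 hPhi.
case: hK => Kfin; set BK := integral_dV _ _ _ => BKfin.
have BK0 : (0 <= BK)%E.
  by apply: integral_ge0 => z z0; rewrite !mule_ge0 ?poweR_ge0 ?lee_fin ?powR_ge0//;
    exact: maximal_ge0.
(* Adding 1 keeps the bound positive even when the integral of K_mu^s is zero; [S1] is built
   likewise. *)
pose B := fine BK + 1.
have B0 : 0 < B by rewrite ltr_wpDl// fine_ge0.
have KB : (BK <= B%:E)%E.
  by rewrite /B EFinD fineK ?ge0_fin_numE// leeDl// lee_fin.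
pose S1 := `|S| + 1.
have S10 : 0 < S1 by rewrite ltr_wpDl.
have {}PhiS n : \sum_(j < n) (2 ^+ j) `^ (- p) * young_ext Phi (2 ^+ j) <= S1.
  by rewrite (le_trans (PhiS n))// /S1 (le_trans (ler_norm S))// lerDl.
pose c1 := 4 * 2 `^ p * S1.
have c10 : 0 < c1 by rewrite !mulr_gt0// powR_gt0.
pose c2 := B `^ (p / (p - q))^-1.
have c20 : 0 < c2 by rewrite powR_gt0.
pose c3 := (2 * doubling alpha) `^ q.
have c30 : 0 < c3.
  by rewrite powR_gt0// mulr_gt0// (lt_le_trans ltr01)// doubling_ge1.
(* [c3] comes from the comparison with the grids, 2 from adding the two grids, and the rest from the
   bound on each grid. *)
pose c := c3 * (2 * (c1 `^ (q / p) * c2)).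
have c0 : 0 < c by rewrite !mulr_gt0// powR_gt0.
exists (c `^ q^-1); first by rewrite powR_gt0.
move=> f mRe mIm; have := X0 f; set X := integral_dV _ _ _ => {}X0.
have gb b := @grid_maximal_integral R alpha p q omega mu Phi f halpha q0 hqp homega
  yPhi wfin Kfin mRe mIm S1 B PhiS B0 KB b.
have mN b : measurable_fun [set: R * R] (fun z => grid_maximal alpha Phi f b z `^ q)%E.
  apply: (measurableT_comp (measurable_poweR q)).
  apply: measurable_indic_sup; first exact: measurable_grid_square.
  exact: grid_coef_ge0.
have key : (\int[mu]_(z in halfplane) (orlicz_maximal alpha Phi f z `^ q) <=
    c%:E * X `^ (q / p))%E.
  rewrite integral_mkcond.
  apply: (@le_trans _ _ (\int[mu]_z (c3%:E *
      (grid_maximal alpha Phi f false z `^ q + grid_maximal alpha Phi f true z `^ q)))%E).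
    apply: ge0_le_integral_lower => z _; rewrite patchE; case: ifPn => //.
    - by rewrite poweR_ge0.
    - by move=> /set_mem z0; exact: orlicz_maximal_poweR_le.
    - by rewrite mule_ge0 ?adde_ge0 ?poweR_ge0// lee_fin ltW.
  rewrite ge0_integralZl_EFin ?(ltW c30)//; last 2 first.
    by move=> z _; rewrite adde_ge0// poweR_ge0.
    exact: emeasurable_funD.
  rewrite ge0_integralD//; last 2 first.
    by move=> z _; rewrite poweR_ge0.
    by move=> z _; rewrite poweR_ge0.
  rewrite /c EFinM -muleA; apply: lee_wpmul2l; first by rewrite lee_fin ltW.
  rewrite !integral_plane_measure//; last 2 first.
    by move=> z; rewrite poweR_ge0.
    by move=> z; rewrite poweR_ge0.
  apply: le_trans (leeD (gb false) (gb true)) _.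
  rewrite -/c1 -/c2 -/X poweRM// ?lee_fin ?(ltW c10)// poweR_EFin.
  rewrite muleAC -EFinM -ge0_muleDl ?lee_fin ?mulr_ge0 ?powR_ge0 ?(ltW c20)//.
  by rewrite -EFinD -mulr2n -[X in X%:E]mulr_natl.
apply: le_trans (ge0_le_poweR _ _ key) _.
- by rewrite invr_ge0 ltW.
- by apply: integral_ge0 => z _; rewrite poweR_ge0.
rewrite poweRM ?lee_fin ?(ltW c0) ?poweR_ge0// poweR_EFin -poweRrM.
by rewrite mulrAC divff ?gt_eqF// mul1r.
Qed.
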